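(* Let $R$ be a countable discrete unital ring, $C$ a locally compact Polish $R$-module and $A$ a pro-Lie Polish $R$-module. Then: (1) $\mathsf{Z}_R(C,A)$ is a closed subgroup of $\mathscr{L}^0_2(C,A)\oplus\prod_{r\in R}\mathscr{L}^0_1(C,A)$, and is therefore a Polish group; (2) $\mathsf{B}_R(C,A)$ is a Polishable subgroup of $\mathsf{Z}_R(C,A)$; explicitly, its Polish topology is the one transported from $\mathscr{L}^0_{1,0}(C,A)/\ker(D)$; (3) the quotient $\mathsf{Ext}^1_{R,\mathrm{coc}}(C,A):=\mathsf{Z}_R(C,A)/\mathsf{B}_R(C,A)$ is a group with a Polish cover.
   Context: Modules are left unital $R$-modules. A Polish $R$-module is a Polish abelian group on which each $r\in R$ acts by a continuous endomorphism; it is locally compact, respectively pro-Lie, if its additive group is (a Polish abelian group $G$ is pro-Lie if every zero neighborhood contains a closed subgroup $H$ with $G/H$ a Lie group). Control measures. For $m,n\ge1$ let $\mathscr{T}_{m,n}(R)$ be the countable set of maps $T:C^m\to C^n$ each of whose coordinates has the form $(x_1,\dots,x_m)\mapsto\sum_j r_jx_j$ with $r_j\in R$. For each $m$ choose a Borel probability measure $\lambda_m$ on $C^m$ equivalent to Haar measure, and let $\mu_n$ be a convex combination, with all weights positive, of all the measures $T_*\lambda_m$ ($m\ge1$, $T\in\mathscr{T}_{m,n}(R)$). The measure class of $\mu_n$ does not depend on choices, the origin has positive mass, and pullback along any $S\in\mathscr{T}_{n,k}(R)$ is well defined on almost-everywhere classes. Let $\mathscr{L}^0_n(C,A):=L^0(C^n,A;\mu_n)$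 be the Polish group of $\mu_n$-a.e. classes of Borel functions $C^n\to A$ with the topology of convergence in measure, and $\mathscr{L}^0_{1,0}(C,A)=\{[f]\in\mathscr{L}^0_1(C,A): f(0)=0\}$. Cocycles. $\mathsf{Z}_R(C,A)\subseteq\mathscr{L}^0_2(C,A)\oplus\prod_{r\in R}\mathscr{L}^0_1(C,A)$ is the group of pairs $(c,\rho)$, $\rho=(\rho_r)_{r\in R}$, such that the following identities hold for all $r,s\in R$, as equalities in the appropriate $\mathscr{L}^0_k(C,A)$ ($k$ = number of variables): $c(x,0)=0$; $c(x,y)=c(y,x)$; $c(x,y)+c(x+y,z)=c(x,y+z)+c(y,z)$; $\rho_r(x)+\rho_r(y)-\rho_r(x+y)=r\,c(x,y)-c(rx,ry)$; $\rho_{r+s}(x)=\rho_r(x)+\rho_s(x)+c(rx,sx)$; $\rho_{rs}(x)=r\rho_s(x)+\rho_r(sx)$; $\rho_0(x)=0$, $\rho_1(x)=0$. Coboundaries. For $f\in\mathscr{L}^0_{1,0}(C,A)$ let $(\delta f)(x,y)=f(x)+f(y)-f(x+y)$ and $(\partial_rf)(x)=rf(x)-f(rx)$. Then $D(f)=(\delta f,(\partial_rf)_{r\in R})$ defines a continuous homomorphism $D:\mathscr{L}^0_{1,0}(C,A)\to\mathsf{Z}_R(C,A)$, and $\mathsf{B}_R(C,A):=\mathrm{im}(D)$. A subgroup $N$ of a Polish abelian group $\hat G$ is Polishable if it has a (necessarily unique) Polish group topology making the inclusion $N\to\hat G$ continuous. A group with a Polish cover is a group explicitly presented as a quotient $\hat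 G/N$ of a Polish abelian group by a Polishable subgroup. *)

(* Defs.v *)
From HB Require Import structures.
From mathcomp Require Import all_boot all_order all_algebra generic_quotient.
From mathcomp Require Import all_classical all_reals all_analysis.

Set Implicit Arguments.
Unset Strict Implicit.
Unset Printing Implicit Defensive.

Import Order.TTheory GRing.Theory Num.Theory.
Import numFieldNormedType.Exports.

Local Open Scope classical_set_scope.
Local Open Scope ring_scope.

Notation preTopZmodType := PreTopologicalZmodule.type.

Section Polish.
Variable K : realType.

Definition metrizes (T : topologicalType) (d : T -> T -> K) : Prop :=
  [/\ forall x y, d x y = 0 <-> x = y,
      forall x y, d x y = d y x,
      forall x y z, d x z <= d x y + d y z &
      forall x, nbhs x =
        filter_from [set e : K | 0 < e] (fun e => [set y | d x y < e])].

Definition dist_complete (T : topologicalType) (d : T -> T -> K) : Prop :=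
  forall u : nat -> T,
    (forall e : K, 0 < e -> exists N, forall m n,
       (N <= m)%N -> (N <= n)%N -> d (u m) (u n) < e) ->
    exists l : T, u n @[n --> \oo] --> l.

Definition polish_space (T : topologicalType) : Prop :=
  (exists2 D : set T, countable D & dense D) /\
  (exists2 d : T -> T -> K, metrizes d & dist_complete d).

Definition polish_group (G : preTopZmodType) : Prop :=
  continuous (fun x : G * G => x.1 - x.2) /\ polish_space G.

End Polish.

(* The module structure is a field rather than an inheritance from
   GRing.Lmodule: a structure joining Topological and GRing.Lmodule R for an
   arbitrary ring R clashes with tvs.NbhsLmodule, which fixes R to be a
   numDomainType. *)
HB.mixin Record isPolishModule (K : realType) (R : pzRingType) M
    & TopologicalZmodule M := {
  scale_mixin : GRing.Zmodule_isLmodule R M ;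
  scale_mixin_continuous : forall r : R,
    continuous (GRing.Zmodule_isLmodule.scale scale_mixin r : M -> M) ;
  polish_carrier : polish_space K M }.

#[short(type="polishModType")]
HB.structure Definition PolishModule (K : realType) (R : pzRingType) :=
  {M of TopologicalZmodule M & isPolishModule K R M}.

Definition lmod_of (K : realType) (R : pzRingType) (M : polishModType K R) :
  Type := M.
HB.instance Definition _ K R (M : polishModType K R) :=
  GRing.Zmodule.copy (lmod_of M) M.
HB.instance Definition _ K R (M : polishModType K R) :
  GRing.Zmodule_isLmodule R (lmod_of M) := @scale_mixin K R M.

Definition act (K : realType) (R : pzRingType) (M : polishModType K R)
  (r : R) (x : M) : M := r *: (x : lmod_of M).
Notation "r *! x" := (act r x) (at level 40, left associativity) : ring_scope.

Lemma act_continuous K R (M : polishModType K R) (r : R) :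
  continuous (act r : M -> M).
Proof. exact: scale_mixin_continuous. Qed.

Definition is_subgroup (G : zmodType) (H : set G) : Prop :=
  H 0 /\ forall x y, H x -> H y -> H (x - y).

Section Subgroup.
Variables (G : preTopZmodType) (H : set G) (HH : is_subgroup H).

Definition subgroup_type : Type := let _ := HH in set_type H.

HB.instance Definition _ := Topological.copy subgroup_type (set_type H).
HB.instance Definition _ := SubType.copy subgroup_type (set_type H).

Let sg0 : subgroup_type := exist _ 0 (mem_set HH.1).
Let sgB (x y : subgroup_type) : subgroup_type :=
  exist _ (val x - val y)
    (mem_set (HH.2 _ _ (set_mem (valP x)) (set_mem (valP y)))).
Let sgN x := sgB sg0 x.
Let sgD x y := sgB x (sgN y).

Let sgDE x y : val (sgD x y) = val x + val y.
Proof. by rewrite /= sub0r opprK. Qed.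
Let sgDA : associative sgD.
Proof. by move=> x y z; apply: val_inj; rewrite !sgDE addrA. Qed.
Let sgDC : commutative sgD.
Proof. by move=> x y; apply: val_inj; rewrite !sgDE addrC. Qed.
Let sg0D : left_id sg0 sgD.
Proof. by move=> x; apply: val_inj; rewrite sgDE add0r. Qed.
Let sgND : left_inverse sg0 sgN sgD.
Proof. by move=> x; apply: val_inj; rewrite sgDE /= sub0r addNr. Qed.

HB.instance Definition _ :=
  GRing.isZmodule.Build subgroup_type sgDA sgDC sg0D sgND.

End Subgroup.

Section QuotientGroup.
Variables (G : preTopZmodType) (N : set G) (HN : is_subgroup N).

Definition coset_rel (x y : G) : bool := let _ := HN in `[< N (x - y) >].

Let coset_rel_refl : reflexive coset_rel.
Proof. by move=> x; apply/asboolP; rewrite subrr; exact: HN.1. Qed.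
Let NN x : N x -> N (- x).
Proof. by move=> Nx; rewrite -sub0r; apply: HN.2 => //; exact: HN.1. Qed.
Let coset_rel_sym : symmetric coset_rel.
Proof.
by move=> x y; apply/asboolP/asboolP => /NN; rewrite opprB.
Qed.
Let coset_rel_trans : transitive coset_rel.
Proof.
move=> y x z /asboolP xy /asboolP yz; apply/asboolP.
by have := HN.2 _ _ xy (NN yz); rewrite opprK addrA subrK.
Qed.

Canonical coset_rel_equiv :=
  EquivRel coset_rel coset_rel_refl coset_rel_sym coset_rel_trans.

Definition quot_group : Type :=
  quotient_topology {eq_quot coset_rel}%qT.

HB.instance Definition _ := Topological.on quot_group.
HB.instance Definition _ := EqQuotient.copy quot_group
  {eq_quot coset_rel}%qT.

Local Open Scope quotient_scope.

Definition coset_pi (x : G) : quot_group := \pi_quot_group x.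

Let qg0 : quot_group := coset_pi 0.
Let qgN (x : quot_group) : quot_group := coset_pi (- repr x).
Let qgD (x y : quot_group) : quot_group := coset_pi (repr x + repr y).

Let piP x y : coset_pi x = coset_pi y <-> N (x - y).
Proof.
by split => [/eqmodP/asboolP//|?]; apply/eqmodP/asboolP.
Qed.

Let reprP (x : G) : N (repr (coset_pi x) - x).
Proof. by apply/piP; rewrite /coset_pi reprK. Qed.

Let ND x y : N x -> N y -> N (x + y).
Proof. by move=> Nx /NN Ny; rewrite -[y]opprK; exact: HN.2. Qed.

Let qgDE x y : qgD (coset_pi x) (coset_pi y) = coset_pi (x + y).
Proof. by apply/piP; rewrite opprD addrACA; apply: ND; exact: reprP. Qed.
Let qgNE x : qgN (coset_pi x) = coset_pi (- x).
Proof. by apply/piP; rewrite -opprD; apply: NN; exact: reprP. Qed.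

Let qgP (P : quot_group -> Prop) : (forall x, P (coset_pi x)) -> forall x, P x.
Proof. by move=> h x; rewrite -[x]reprK; exact: h. Qed.

Let qgDA : associative qgD.
Proof.
by elim/qgP => x; elim/qgP => y; elim/qgP => z; rewrite !qgDE addrA.
Qed.
Let qgDC : commutative qgD.
Proof. by elim/qgP => x; elim/qgP => y; rewrite !qgDE addrC. Qed.
Let qg0D : left_id qg0 qgD.
Proof. by elim/qgP => x; rewrite qgDE add0r. Qed.
Let qgND : left_inverse qg0 qgN qgD.
Proof. by elim/qgP => x; rewrite qgNE qgDE addNr. Qed.

HB.instance Definition _ :=
  GRing.isZmodule.Build quot_group qgDA qgDC qg0D qgND.

End QuotientGroup.

Record topology_on (T : Type) := TopologyOn {
  opens :> set (set T) ;
  opens_setT : opens setT ;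
  opens_setI : setI_closed opens ;
  opens_bigcup : forall (I : Type) (f : I -> set T),
    (forall i, opens (f i)) -> opens (\bigcup_i f i) }.

Definition retopo (T : Type) (t : topology_on T) : Type := T.

HB.instance Definition _ (T : zmodType) (t : topology_on T) :=
  GRing.Zmodule.copy (retopo t) T.
HB.instance Definition _ (T : zmodType) (t : topology_on T) :=
  isOpenTopological.Build (retopo t)
    (opens_setT t) (@opens_setI _ t) (@opens_bigcup _ t).

Section Transport.
Variables (S : topologicalType) (T : Type) (f : S -> T).

(* For bijective f this is the topology of S transported along f. *)
Definition transport : topology_on T.
Proof.
exists [set V | open (f @^-1` V)].
- by rewrite /= preimage_setT; exact: openT.
- by move=> U V /= oU oV; rewrite preimage_setI; exact: openI.
- by move=> I F oF /=; rewrite preimage_bigcup; apply: bigcup_open => i _; exact: oF.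
Defined.

End Transport.

Section Polishable.
Variables (K : realType) (G : preTopZmodType) (N : set G) (HN : is_subgroup N).

Definition polishing (t : topology_on (subgroup_type HN)) : Prop :=
  polish_group K (retopo t) /\ continuous (fun x : retopo t => (\val x : G)).

Definition polishable : Prop := exists t, polishing t.

End Polishable.

Variant group_with_polish_cover (K : realType) : zmodType -> Prop :=
  PolishCover (G : preTopZmodType) (N : set G) (HN : is_subgroup N)
    of polish_group K G & polishable K HN :
    group_with_polish_cover K (quot_group HN).

Section LieGroup.
Variable K : realType.

(* Only used for open U. *)
Fixpoint Ck_on (k : nat) (V W : normedModType K) (U : set V) (f : V -> W) :
    Prop :=
  if k is k'.+1 then
    (forall x, U x -> differentiable f x) /\
    (forall v, Ck_on k' U (fun x => 'D_v f x))
  else forall x, U x -> {for x, continuous f}.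

Definition smooth_on (V W : normedModType K) (U : set V) (f : V -> W) : Prop :=
  forall k, Ck_on k U f.

(* The maps are total; only their restrictions to the domain and to the
   codomain are meaningful. *)
Record chart (G : topologicalType) (n : nat) := Chart {
  chart_dom : set G ;
  chart_cod : set 'rV[K]_n ;
  chart_fun : G -> 'rV[K]_n ;
  chart_inv : 'rV[K]_n -> G ;
  open_chart_dom : open chart_dom ;
  open_chart_cod : open chart_cod ;
  chart_funP : forall x, chart_dom x -> chart_cod (chart_fun x) ;
  chart_invP : forall u, chart_cod u -> chart_dom (chart_inv u) ;
  chart_funK : forall x, chart_dom x -> chart_inv (chart_fun x) = x ;
  chart_invK : forall u, chart_cod u -> chart_fun (chart_inv u) = u ;
  chart_fun_cts : forall x, chart_dom x -> {for x, continuous chart_fun} ;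
  chart_inv_cts : forall u, chart_cod u -> {for u, continuous chart_inv} }.

Definition is_lie_group (G : preTopZmodType) : Prop :=
  [/\ hausdorff_space G, @second_countable G,
      continuous (fun x : G * G => x.1 - x.2) &
  exists n (atlas : set (chart G n)),
    [/\ forall x, exists2 c, atlas c & chart_dom c x,
        forall c1 c2, atlas c1 -> atlas c2 ->
          smooth_on [set u | chart_cod c1 u /\ chart_dom c2 (chart_inv c1 u)]
            (fun u => chart_fun c2 (chart_inv c1 u)),
        forall c1 c2 c3, atlas c1 -> atlas c2 -> atlas c3 ->
          smooth_on [set uv : 'rV[K]_n * 'rV[K]_n |
              [/\ chart_cod c1 uv.1, chart_cod c2 uv.2 &
                  chart_dom c3 (chart_inv c1 uv.1 + chart_inv c2 uv.2)]]
            (fun uv => chart_fun c3 (chart_inv c1 uv.1 + chart_inv c2 uv.2)) &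
        forall c1 c2, atlas c1 -> atlas c2 ->
          smooth_on [set u | chart_cod c1 u /\ chart_dom c2 (- chart_inv c1 u)]
            (fun u => chart_fun c2 (- chart_inv c1 u))]].

Definition pro_lie (G : preTopZmodType) : Prop :=
  forall U : set G, nbhs 0 U ->
    exists (H : set G) (HH : is_subgroup H),
      [/\ closed H, H `<=` U & is_lie_group (quot_group HH)].

End LieGroup.

Section Borel.

(* measurableType requires a point; zmodType does not provide one. *)
Definition pointed_at0 (X : preTopZmodType) : Type := X.
HB.instance Definition _ (X : preTopZmodType) := Choice.on (pointed_at0 X).
HB.instance Definition _ (X : preTopZmodType) :=
  isPointed.Build (pointed_at0 X) (0 : X).

Definition borel (X : preTopZmodType) :=
  g_sigma_algebraType (@open X : set (set (pointed_at0 X))).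

Lemma borel_open (X : preTopZmodType) (U : set X) :
  open U -> measurable (U : set (borel X)).
Proof. exact: sub_sigma_algebra. Qed.

Lemma continuous_borel (X Y : preTopZmodType) (f : X -> Y) :
  continuous f -> measurable_fun [set: borel X] (f : borel X -> borel Y).
Proof.
move=> /continuousP cf.
apply: (@measurability _ _ (borel X) (borel Y) _ _ (@open Y)) => //.
move=> _ [U oU <-]; rewrite setTI; apply: borel_open; exact: cf.
Qed.

End Borel.

Section SumMeasurable.
Context (K : realType) (R : pzRingType) (A : polishModType K R).

Lemma measurable_funB_borel d (T : measurableType d) (f g : T -> borel A) :
  measurable_fun [set: T] f -> measurable_fun [set: T] g ->
  measurable_fun [set: T] ((fun x => (f x : A) - (g x : A)) : T -> borel A).
Proof.
move=> mf mg.
have [[D cD dD] [dist [d0 dC dT dN] _]] := polish_carrier (s := A).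
pose B (x : A) (n : nat) := [set y : A | dist x y < n.+1%:R^-1].
have n0 n : 0 < (n.+1%:R^-1 : K) by rewrite invr_gt0 ltr0n.
have oB x n : open (B x n).
  rewrite openE => y xy; rewrite /interior dN.
  exists (n.+1%:R^-1 - dist x y); first by rewrite /= subr_gt0.
  move=> z /= yz; have := dT x y z; rewrite /B /=.
  by move=> /le_lt_trans; apply; rewrite addrC -ltrBrDr.
have dxx x : dist x x = 0 by apply/d0.
have small (x : A) V : nbhs x V -> exists p n, [/\ D p, B p n x & B p n `<=` V].
  rewrite dN => -[e /= e0 eV].
  have e20 : 0 < e / 2 by rewrite divr_gt0.
  have [n _ nE] := near_infty_natSinv_lt (PosNum e20).
  have [p [px Dp]] : B x n `&` D !=set0.
    by apply: dD => //; exists x; rewrite /B /= dxx.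
  exists p, n; split => //; first by rewrite /B /= dC.
  move=> y py; apply: eV => /=.
  have := dT x p y => /le_lt_trans; apply; rewrite [e]splitr.
  by have /= nlt := nE n (leqnn n); rewrite ltrD// (lt_trans _ nlt).
have [e De] : exists e : nat -> A, D `<=` range e.
  move/pfcard_geP : cD => [->|[e]]; first by exists (fun=> 0).
  by exists e => x Dx; have [n _ <-] := @surj _ _ _ _ e x Dx; exists n.
apply: (@measurability _ _ T (borel A) _ _ (@open A)) => //.
move=> _ [U oU <-]; rewrite setTI.
pose P (i : nat * nat * nat * nat) := forall x y : A,
  B (e i.1.1.1) i.1.1.2 x -> B (e i.1.2) i.2 y -> U (x - y).
pose F i := if `[< P i >] then
  f @^-1` B (e i.1.1.1) i.1.1.2 `&` g @^-1` B (e i.1.2) i.2 else set0.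
rewrite (_ : _ @^-1` U = \bigcup_i F i); last first.
  rewrite eqEsubset; split => t /=.
    move=> Ut.
    have /= [[V W] /= [Vf Wg] VW] :=
      @sub_continuous A (f t : A, g t : A) U (open_nbhs_nbhs (conj oU Ut)).
    have [p [n [Dp pf pV]]] := small _ _ Vf.
    have [q [m [Dq qg qW]]] := small _ _ Wg.
    have [a _ aE] := De _ Dp; have [b _ bE] := De _ Dq.
    exists (a, n, b, m) => //; rewrite /F /=; case: asboolP => [_|].
      by rewrite aE bE.
    case=> x y; rewrite /= aE bE => /pV Vx /qW Wy.
    exact: (VW (x, y)).
  by move=> [i _]; rewrite /F; case: asboolP => // Pi [/= fi gi]; exact: Pi.
apply: countable_bigcupT_measurable => // i; rewrite /F; case: asboolP => // _.
have mo (h : T -> borel A) V : measurable_fun [set: T] h -> open V ->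
    measurable (h @^-1` V).
  move=> mh oV; rewrite -[_ @^-1` _]setTI; apply: mh => //; exact: borel_open.
by apply: measurableI; apply: mo.
Qed.

Lemma measurable_funD_borel d (T : measurableType d) (f g : T -> borel A) :
  measurable_fun [set: T] f -> measurable_fun [set: T] g ->
  measurable_fun [set: T] ((fun x => (f x : A) + (g x : A)) : T -> borel A).
Proof.
move=> mf mg.
have m0 : measurable_fun [set: T] (cst 0 : T -> borel A) by exact: measurable_cst.
have := measurable_funB_borel mf (measurable_funB_borel m0 mg).
by congr measurable_fun; apply/funext => x; rewrite sub0r opprK.
Qed.

End SumMeasurable.

Section L0.
Context (K : realType) (R : pzRingType) (X : preTopZmodType).
Context (mu : {measure set (borel X) -> \bar K}) (A : polishModType K R).

Definition L0 : Type := {mfun_ mu, borel X >-> borel A}.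

HB.instance Definition _ := Choice.on L0.
HB.instance Definition _ := EqQuotient.on L0.

Definition L0_fun (f : L0) : X -> A := (repr f : {mfun borel X >-> borel A}).

Let aeF : Filter (almost_everywhere mu).
Proof. exact: ae_filter_ringOfSetsType. Qed.

Let aeS (P Q : borel X -> Prop) :
  {ae mu, forall x, P x} -> (forall x, P x -> Q x) -> {ae mu, forall x, Q x}.
Proof. by move=> + PQ; exact: (@filterS _ _ aeF). Qed.

Let aeI (P Q : borel X -> Prop) : {ae mu, forall x, P x} ->
  {ae mu, forall x, Q x} -> {ae mu, forall x, P x /\ Q x}.
Proof. exact: (@filterI _ _ aeF). Qed.

Lemma L0_measurable (f : L0) :
  measurable_fun setT (L0_fun f : borel X -> borel A).
Proof. exact: measurable_funPT. Qed.

Definition borel_mfun (f : borel X -> borel A) (mf : measurable_fun setT f) :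
    {mfun borel X >-> borel A} :=
  HB.pack_for {mfun borel X >-> borel A} f
    (isMeasurableFun.Build _ _ _ _ f mf).

Definition L0_class (f : borel X -> borel A) (mf : measurable_fun setT f) : L0 :=
  \pi_L0%qT (borel_mfun mf).

Lemma L0_eqP (f g : L0) :
  f = g <-> {ae mu, forall x, L0_fun f x = L0_fun g x}.
Proof.
split=> [->|fg]; first exact/aeW.
rewrite -[f]reprK -[g]reprK; apply/eqmodP/asboolP.
by apply: (aeS fg) => x.
Qed.

Lemma L0_classE (f : borel X -> borel A) (mf : measurable_fun setT f) :
  {ae mu, forall x, L0_fun (L0_class mf) x = f x}.
Proof.
rewrite /L0_fun /L0_class.
set F := borel_mfun mf.
have /eqmodP/asboolP : \pi_L0%qT (repr (\pi_L0%qT F)) = \pi_L0%qT F by rewrite reprK.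
by move=> h; apply: (aeS h) => x /(_ I).
Qed.

Definition L0_zero : L0 := L0_class (measurable_cst (0 : borel A)).
Definition L0_sub (f g : L0) : L0 :=
  L0_class (measurable_funB_borel (L0_measurable f) (L0_measurable g)).
Definition L0_opp (f : L0) : L0 := L0_sub L0_zero f.
Definition L0_add (f g : L0) : L0 :=
  L0_class (measurable_funD_borel (L0_measurable f) (L0_measurable g)).

Lemma L0_addE f g :
  {ae mu, forall x, L0_fun (L0_add f g) x = L0_fun f x + L0_fun g x}.
Proof. exact: L0_classE. Qed.
Lemma L0_zeroE : {ae mu, forall x, L0_fun L0_zero x = 0}.
Proof. exact: L0_classE. Qed.
Lemma L0_oppE f : {ae mu, forall x, L0_fun (L0_opp f) x = - L0_fun f x}.
Proof.
have hB : {ae mu, forall x,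
    L0_fun (L0_opp f) x = L0_fun L0_zero x - L0_fun f x} by exact: L0_classE.
by apply: (aeS (aeI L0_zeroE hB)) => x [e ->]; rewrite e sub0r.
Qed.

Lemma L0_addA : associative L0_add.
Proof.
move=> f g h; apply/L0_eqP.
have h4 := aeI (aeI (L0_addE f g) (L0_addE g h))
  (aeI (L0_addE f (L0_add g h)) (L0_addE (L0_add f g) h)).
by apply: (aeS h4) => x [[fg gh] [-> ->]]; rewrite fg gh addrA.
Qed.
Lemma L0_addC : commutative L0_add.
Proof.
move=> f g; apply/L0_eqP.
by apply: (aeS (aeI (L0_addE f g) (L0_addE g f))) => x [-> ->]; rewrite addrC.
Qed.
Lemma L0_add0 : left_id L0_zero L0_add.
Proof.
move=> f; apply/L0_eqP.
by apply: (aeS (aeI (L0_addE L0_zero f) L0_zeroE)) => x [-> ->]; rewrite add0r.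
Qed.
Lemma L0_addN : left_inverse L0_zero L0_opp L0_add.
Proof.
move=> f; apply/L0_eqP.
have h3 := aeI (L0_addE (L0_opp f) f) (aeI (L0_oppE f) L0_zeroE).
by apply: (aeS h3) => x [-> [-> ->]]; rewrite addNr.
Qed.

HB.instance Definition _ :=
  GRing.isZmodule.Build L0 L0_addA L0_addC L0_add0 L0_addN.

Lemma L0D f g : {ae mu, forall x, L0_fun (f + g) x = L0_fun f x + L0_fun g x}.
Proof. exact: L0_addE. Qed.
Lemma L0N f : {ae mu, forall x, L0_fun (- f) x = - L0_fun f x}.
Proof. exact: L0_oppE. Qed.
Lemma L0B f g : {ae mu, forall x, L0_fun (f - g) x = L0_fun f x - L0_fun g x}.
Proof. by apply: (aeS (aeI (L0D f (- g)) (L0N g))) => x [-> ->]. Qed.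

(* Basic neighbourhoods for convergence in measure: g is close to f when g - f
   lies in the neighbourhood U of 0 outside a set of small measure. On a finite
   measure space this is the topology of convergence in measure for any
   compatible metric on A. *)
Definition far_set (f g : L0) (U : set A) : set (borel X) :=
  [set x | ~ U (L0_fun g x - L0_fun f x)].

Definition near_in_measure (f : L0) (U : set A) (e : K) : set L0 :=
  [set g | (mu (far_set f g U) < e%:E)%E].

Definition L0_nbhs (f : L0) : set_system L0 :=
  [set V | exists (U : set A) (e : K), [/\ open U, U 0, 0 < e & near_in_measure f U e `<=` V]].

HB.instance Definition _ := hasNbhs.Build L0 L0_nbhs.

Lemma measurable_far_set (f g : L0) (U : set A) : open U ->
  measurable (far_set f g U).
Proof.
move=> oU; have := measurable_funB_borel (L0_measurable g) (L0_measurable f).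
move=> /(_ measurableT (~` (U : set (borel A)))); rewrite setTI; apply.
by apply: measurableC; exact: (borel_open oU).
Qed.

Lemma L0_nbhs_refl f U e : U 0 -> 0 < e -> near_in_measure f U e f.
Proof.
move=> U0 e0; rewrite /near_in_measure /= (_ : far_set f f U = set0) ?measure0 ?lte_fin//.
by rewrite -subset0 => x; rewrite /far_set /= subrr.
Qed.

Lemma L0_nbhs_filter f : ProperFilter (L0_nbhs f).
Proof.
apply: Build_ProperFilter_ex.
  by move=> V [U [e [_ U0 e0 UV]]]; exists f; apply: UV; exact: L0_nbhs_refl.
split.
- by exists setT, 1; split => //; exact: openT.
- move=> V W [U [e [oU U0 e0 UV]]] [U' [e' [oU' U'0 e'0 UW]]].
  exists (U `&` U'), (Num.min e e'); split => //; first exact: openI.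
    by rewrite lt_min e0.
  move=> g; rewrite /near_in_measure /= => h; split.
    apply: UV; rewrite /near_in_measure /=; apply: le_lt_trans (lt_le_trans h _).
      by apply: le_measure; rewrite ?inE; do ?exact: measurable_far_set;
        [apply: measurable_far_set; exact: openI|move=> x nU [? ?]; exact: nU].
    by rewrite lee_fin ge_min lexx.
  apply: UW; rewrite /near_in_measure /=; apply: le_lt_trans (lt_le_trans h _).
    by apply: le_measure; rewrite ?inE; do ?exact: measurable_far_set;
      [apply: measurable_far_set; exact: openI|move=> x nU [? ?]; exact: nU].
  by rewrite lee_fin ge_min lexx orbT.
- move=> V W VW [U [e [oU U0 e0 UV]]]; exists U, e; split => //.
  exact: subset_trans VW.
Qed.

Lemma L0_nbhs_singleton f (V : set L0) : L0_nbhs f V -> V f.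
Proof. by move=> [U [e [_ U0 e0]]]; apply; exact: L0_nbhs_refl. Qed.

Lemma L0_nbhs_nbhs f (V : set L0) : L0_nbhs f V -> L0_nbhs f (L0_nbhs^~ V).
Proof.
move=> [U [e [oU U0 e0 UV]]].
have : nbhs (0 + 0 : A) U by rewrite addr0; exact: open_nbhs_nbhs.
move=> /(@add_continuous A (0, 0)) [[P Q] /= [P0 Q0] PQ].
rewrite !nbhsE in P0 Q0; have [P' [oP' P'0] PP] := P0.
have [Q' [oQ' Q'0] QQ] := Q0; have e20 : 0 < e / 2 by rewrite divr_gt0.
exists P', (e / 2); split => // g gf; exists Q', (e / 2); split => // h hg.
apply: UV; rewrite /near_in_measure /=.
apply: (@le_lt_trans _ _ (mu (far_set f g P' `|` far_set g h Q'))).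
  apply: le_measure; rewrite ?inE; first exact: measurable_far_set.
    by apply: measurableU; exact: measurable_far_set.
  move=> x nU; have [p|] := pselect (P' (L0_fun g x - L0_fun f x)); last by left.
  right => q; apply: nU; have := PQ (L0_fun g x - L0_fun f x, L0_fun h x - L0_fun g x).
  by rewrite /= [X in U X]addrC subrKA; apply; split; [exact: PP|exact: QQ].
apply: (le_lt_trans (measureU2 _ _ _)); do ?exact: measurable_far_set.
by rewrite [e]splitr EFinD; exact: lteD.
Qed.

HB.instance Definition _ := Nbhs_isNbhsTopological.Build L0
  L0_nbhs_filter L0_nbhs_singleton L0_nbhs_nbhs.

End L0.

HB.instance Definition _ (m n : nat) (G : preTopZmodType) :=
  Topological.copy 'M[G]_(m, n) 'M[G]_(m, n).
Section ControlMeasures.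
Variables (K : realType) (R : pzRingType) (C : polishModType K R).

Definition is_haar (G : preTopZmodType) (h : {measure set (borel G) -> \bar K}) :
    Prop :=
  [/\ forall (x : G) (B : set (borel G)), measurable B ->
        h ((fun y : G => x + y) @^-1` B) = h B,
      forall Q : set G, compact Q -> (h Q < +oo)%E &
      forall U : set G, open U -> U !=set0 -> (0 < h U)%E].

Definition equivalent_to_haar (G : preTopZmodType)
    (l : {measure set (borel G) -> \bar K}) : Prop :=
  exists h : {measure set (borel G) -> \bar K},
    [/\ is_haar h, h `<< l & l `<< h].

(* Indexed by maps, not by matrices: distinct matrices may induce the same map. *)
Definition comb_maps (m n : nat) : set ('rV[C]_m -> 'rV[C]_n) :=
  [set T : 'rV[C]_m -> 'rV[C]_n | forall i, exists r : 'I_m -> R,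
     forall x : 'rV[C]_m, T x 0 i = \sum_(j < m) r j *! x 0 j].

Definition comb_index (n : nat) :=
  {classic {m : nat & 'rV[C]_m -> 'rV[C]_n}}.

Definition comb_indices (n : nat) : set (comb_index n) :=
  [set p | (0 < tag p)%N /\ comb_maps (tagged p)].

Definition control_measures
    (mu : forall n, probability (borel 'rV[C]_n) K) : Prop :=
  exists2 lam : forall m, probability (borel 'rV[C]_m) K,
    forall m, (0 < m)%N -> equivalent_to_haar (lam m) &
    forall n, (0 < n)%N -> exists w : comb_index n -> K,
      [/\ forall p, comb_indices p -> 0 < w p,
          (\esum_(p in @comb_indices n) (w p)%:E = 1)%E &
          forall B : set (borel 'rV[C]_n), measurable B ->
            (mu n B = \esum_(p in @comb_indices n)
               (w p)%:E * lam (tag p) (tagged p @^-1` B))%E].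

End ControlMeasures.

HB.instance Definition _ (I : Type) (G : preTopZmodType) :=
  GRing.Zmodule.copy {ptws I -> G} (I -> G).
HB.instance Definition _ (G H : preTopZmodType) :=
  Topological.copy (G * H)%type (G * H)%type.

Section Cochains.
Variables (K : realType) (R : pzRingType) (C A : polishModType K R).
Variable mu : forall n, probability (borel 'rV[C]_n) K.

Definition vec (n : nat) (s : seq C) : 'rV[C]_n := \row_(i < n) s`_i.

Local Notation L n := (L0 (mu n) A).

Definition app1 (f : L 1) (x : C) : A := L0_fun f (vec 1 [:: x]).
Definition app2 (c : L 2) (x y : C) : A := L0_fun c (vec 2 [:: x; y]).

Lemma rV_coord_continuous (n : nat) (i : 'I_n) :
  continuous (fun v : 'rV[C]_n => v 0 i).
Proof.
move=> v V vV.
exists (fun _ j => if j == i then V else setT).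
  by move=> j k; have [->|_] := eqVneq k i; [rewrite ord1|exact: filterT].
by move=> w /= /(_ 0 i); rewrite eqxx.
Qed.

Lemma app1_measurable (f : L 1) (n : nat) (g : 'rV[C]_n -> C) :
  continuous g ->
  measurable_fun setT ((fun v => app1 f (g v)) : borel 'rV[C]_n -> borel A).
Proof.
move=> cg.
have cv : continuous (fun v => vec 1 [:: g v]).
  move=> v V [P vP PV].
  have : nbhs v (g @^-1` P 0 0).
    by apply: cg; have := vP 0 0; rewrite /vec mxE.
  apply: filterS => w Pw; apply: PV => i j.
  by rewrite !ord1 /vec mxE.
exact: measurableT_comp (L0_measurable f) (continuous_borel cv).
Qed.

Lemma act_measurable (r : R) :
  measurable_fun setT (act r : borel A -> borel A).
Proof. exact: (@continuous_borel A A (act r) (@act_continuous K R A r)). Qed.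

Lemma delta_measurable (f : L 1) : measurable_fun setT
  ((fun v => app1 f (v 0 0) + app1 f (v 0 1) - app1 f (v 0 0 + v 0 1))
     : borel 'rV[C]_2 -> borel A).
Proof.
apply: measurable_funB_borel; first apply: measurable_funD_borel.
- by apply: app1_measurable; exact: rV_coord_continuous.
- by apply: app1_measurable; exact: rV_coord_continuous.
- apply: (@app1_measurable f 2 (fun v => v 0 0 + v 0 1)) => v.
  apply: (@continuous_comp _ (C * C)%type _ (fun w : 'rV[C]_2 => (w 0 0, w 0 1))
    (fun x : C * C => x.1 + x.2)); last exact: add_continuous.
  have h0 := @rV_coord_continuous 2 0 v; have h1 := @rV_coord_continuous 2 1 v.
  exact: (cvg_pair h0 h1).
Qed.

Definition delta (f : L 1) : L 2 := L0_class (mu 2) (delta_measurable f).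

Lemma partial_measurable (f : L 1) (r : R) : measurable_fun setT
  ((fun v => r *! app1 f (v 0 0) - app1 f (r *! v 0 0))
     : borel 'rV[C]_1 -> borel A).
Proof.
apply: measurable_funB_borel.
  apply: (measurableT_comp (act_measurable r)).
  by apply: app1_measurable; exact: rV_coord_continuous.
apply: (@app1_measurable f 1 (fun v => r *! v 0 0)) => v.
by apply: continuous_comp; [exact: rV_coord_continuous|exact: act_continuous].
Qed.

Definition partial (r : R) (f : L 1) : L 1 := L0_class (mu 1) (partial_measurable f r).

Definition cochains : preTopZmodType := (L 2 * {ptws R -> L 1})%type.

(* The equations are between pullbacks of classes along maps in comb_maps; under
   control_measures such pullbacks do not depend on the representatives, so
   they are stated almost everywhere for the representatives app1 and app2. *)
Definition cocycles : set cochains := [set crho |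
  let c := app2 crho.1 in let rho r := app1 (crho.2 r) in
  [/\ {ae mu 1, forall v : borel 'rV[C]_1, c (v 0 0) 0 = 0},
      {ae mu 2, forall v : borel 'rV[C]_2, c (v 0 0) (v 0 1) = c (v 0 1) (v 0 0)},
      {ae mu 3, forall v : borel 'rV[C]_3,
        let x := v 0 0 in let y := v 0 1 in let z := v 0 2 in
        c x y + c (x + y) z = c x (y + z) + c y z} &
  [/\ forall r, {ae mu 2, forall v : borel 'rV[C]_2,
        let x := v 0 0 in let y := v 0 1 in
        rho r x + rho r y - rho r (x + y) = r *! c x y - c (r *! x) (r *! y)},
      forall r s, {ae mu 1, forall v : borel 'rV[C]_1, let x := v 0 0 in
        rho (r + s) x = rho r x + rho s x + c (r *! x) (s *! x)},
      forall r s, {ae mu 1, forall v : borel 'rV[C]_1, let x := v 0 0 in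
        rho (r * s) x = r *! rho s x + rho r (s *! x)},
      {ae mu 1, forall v : borel 'rV[C]_1, rho 0 (v 0 0) = 0} &
      {ae mu 1, forall v : borel 'rV[C]_1, rho 1 (v 0 0) = 0}]]].

(* Under control_measures the origin has positive mass, so the value at 0 depends
   only on the class. *)
Definition normalized : set (L 1) := [set f | app1 f 0 = 0].

Definition cobord (f : L 1) : cochains := (delta f, fun r => partial r f).

Definition coboundaries : set cochains := cobord @` normalized.

Definition cobord_ker (H0 : is_subgroup normalized) :
    set (subgroup_type H0) := [set f | cobord (val f) = 0].

Definition coboundaries_in (HZ : is_subgroup cocycles) :
    set (subgroup_type HZ) := [set z | coboundaries (val z)].

Definition Ext1coc (HZ : is_subgroup cocycles)
  (HB : is_subgroup (@coboundaries_in HZ)) : zmodType := quot_group HB.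

End Cochains.

Arguments cocycles {K R C} A mu _.
Arguments normalized {K R C} A mu _.
Arguments coboundaries {K R C} A mu _.
Arguments cobord_ker {K R C A mu} H0 _.
Arguments coboundaries_in {K R C A mu} HZ _.

(* Main.v *)
Require Import Defs.
From HB Require Import structures.
From mathcomp Require Import all_boot all_order all_algebra generic_quotient.
From mathcomp Require Import all_classical all_reals all_analysis.

Set Implicit Arguments.
Unset Strict Implicit.
Unset Printing Implicit Defensive.

Import Order.TTheory GRing.Theory Num.Theory.
Import numFieldNormedType.Exports.

Local Open Scope classical_set_scope.
Local Open Scope ring_scope.

(** A Polish abelian group is the same as a separable, first countable, Hausdorff
    topological abelian group that is complete for its group uniformity (one
    direction is Klee's theorem, the other the Birkhoff-Kakutani metrization).
    In this form the property passes to [L0], to countable products, to closed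
    subgroups and to quotients by closed subgroups.  A positive combination of
    all the images of the [lam m] under linear maps has the feature that
    preimages of null sets under linear maps are null; by absolute continuity,
    precomposition with such a map is then a continuous homomorphism between the
    [L0] groups.  Hence the cocycle identities cut out kernels of continuous
    homomorphisms, the coboundary map [D] is a continuous homomorphism, and the
    image of [D] carries the topology of the Polish group
    [normalized / ker D]. *)

(** * Topological abelian groups *)

(** The metric in [polish_space] need not be invariant, so being Cauchy for it is not a notion of
    the group, and it does not pass to cosets. Completeness is therefore measured by neighbourhoods
    of 0 alone. In a base with [U n.+1 + U n.+1] inside [U n], a sequence whose k-th step lies in
    [U k] is Cauchy, and every Cauchy sequence has such a subsequence. These sequences are what can
    be handled: in a quotient the steps lift one at a time, and in [L0] the exceptional sets have
    summable measures, so the sequence converges pointwise outside sets of arbitrarily small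
    measure. Countability of [R] keeps the product over [R] first countable and separable. The zero
    map is one of the linear maps, so evaluation at 0 is itself a pullback, and [normalized] is
    closed for the same reason as the set of cocycles. *)

Lemma sub_interchange (V : zmodType) (x y z t : V) :
  x - y - (z - t) = (x - z) - (y - t).
Proof. by rewrite !opprB [t - z]addrC addrACA [- y + t]addrC. Qed.

Definition continuous_sub (G : preTopZmodType) : Prop :=
  continuous (fun x : G * G => x.1 - x.2).

Section TopologicalGroup.
Variables (G : preTopZmodType) (cG : continuous_sub G).

Lemma cvg_sub (T : Type) (F : set_system T) (FF : Filter F) (f g : T -> G) (a b : G) :
  f x @[x --> F] --> a -> g x @[x --> F] --> b ->
  (f x - g x) @[x --> F] --> a - b.
Proof.
move=> fa gb.
move=> V Vab; have [[P Q] /= [Pa Qb] PQ] := @cG (a, b) V Vab.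
have h : F (f @^-1` P `&` g @^-1` Q) by apply: filterI; [exact: fa|exact: gb].
change (F [set x | V (f x - g x)]).
by apply: filterS h => x [Px Qx]; exact: (PQ (f x, g x)).
Qed.

Lemma cvg_opp (T : Type) (F : set_system T) (FF : Filter F) (f : T -> G) (a : G) :
  f x @[x --> F] --> a -> (- f x) @[x --> F] --> - a.
Proof.
move=> fa; rewrite -sub0r; under eq_fun do rewrite -sub0r.
by apply: cvg_sub => //; exact: cvg_cst.
Qed.

Lemma cvg_add (T : Type) (F : set_system T) (FF : Filter F) (f g : T -> G) (a b : G) :
  f x @[x --> F] --> a -> g x @[x --> F] --> b ->
  (f x + g x) @[x --> F] --> a + b.
Proof.
move=> fa gb; rewrite -[b]opprK; under eq_fun do rewrite -[g _]opprK.
by apply: cvg_sub => //; exact: cvg_opp.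
Qed.

Lemma nbhs_shift (x : G) (V : set G) :
  nbhs x V <-> nbhs 0 [set u | V (x + u)].
Proof.
split=> [xV|V0].
  have : (x + u) @[u --> (0 : G)] --> x + 0.
    by apply: cvg_add; [exact: cvg_cst|exact: cvg_id].
  by rewrite addr0; apply.
have : (y - x) @[y --> x] --> x - x.
  by apply: cvg_sub; [exact: cvg_id|exact: cvg_cst].
rewrite subrr => /(_ _ V0) /=; rewrite /nbhs /=.
by apply: filterS => y /=; rewrite addrC subrK.
Qed.

Lemma nbhs0_half (V : set G) : nbhs 0 V -> exists W : set G,
  [/\ open W, W 0, forall x, W x -> W (- x) &
      forall x y, W x -> W y -> V (x + y)].
Proof.
move=> V0.
have [[P Q] /= [P0 Q0] PQ] : nbhs ((0, 0) : G * G) [set xy | V (xy.1 - xy.2)].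
  by apply: (@cG (0, 0)) => /=; rewrite subrr.
have : nbhs 0 (P `&` Q) by exact: filterI.
rewrite nbhsE => -[W [oW W0] WPQ].
have oNW : open [set x : G | W (- x)].
  rewrite openE => x /= Wx; rewrite /interior.
  by apply: (cvg_opp (f := id) (a := x) _ _); [exact: cvg_id|exact: open_nbhs_nbhs].
exists (W `&` [set x | W (- x)]); split.
- exact: openI.
- by split => //=; rewrite oppr0.
- by move=> x [Wx Wnx]; split => //=; rewrite opprK.
- move=> x y [/WPQ[Px _] _] [_ /= /WPQ[_ Qy]].
  by have := PQ (x, - y) (conj Px Qy); rewrite /= opprK.
Qed.

(** * Halving bases and Cauchy sequences *)

Definition base0 (B : nat -> set G) : Prop :=
  (forall n, nbhs 0 (B n)) /\
  forall V, nbhs 0 V -> exists n, B n `<=` V.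

(** Plays the role of the balls of radius [2^-n] of an invariant metric: [hb_add] is the triangle
    inequality, one unit of index standing for a factor 2. *)
Record halving_base (U : nat -> set G) : Prop := HalvingBase {
  hb_open : forall n, open (U n) ;
  hb_zero : forall n, U n 0 ;
  hb_opp : forall n x, U n x -> U n (- x) ;
  hb_add : forall n x y, U n.+1 x -> U n.+1 y -> U n (x + y) ;
  hb_base : forall V, nbhs 0 V -> exists n, U n `<=` V }.

Lemma halving_base_exists B : base0 B ->
  exists2 U, halving_base U & forall n, U n `<=` B n.
Proof.
move=> [B0 Bs].
pose good V (W : set G) := [/\ open W, W 0, forall x, W x -> W (- x) &
      forall x y, W x -> W y -> V (x + y)].
have /choice[S SP] : forall V, exists W, nbhs 0 V -> good V W.
  move=> V; have [/nbhs0_half[W gW]|nV] := pselect (nbhs 0 V); first by exists W.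
  by exists setT.
(* Intersecting with [B n] before halving keeps the new sets inside the given base, hence makes them
   a base too; [S V] lies in [V] because it contains 0. *)
pose U := fix U n := if n is m.+1 then S (U m `&` B n) else S (B 0).
have U0 n : nbhs 0 (U n).
  elim: n => [|n IH] /=.
    by have [oW W0 _ _] := SP _ (B0 0); exact: open_nbhs_nbhs.
  by have [oW W0 _ _] := SP _ (filterI IH (B0 n.+1)); exact: open_nbhs_nbhs.
have UI n : nbhs 0 (U n `&` B n.+1) by exact: filterI.
have UB n : U n `<=` B n.
  case: n => [|n] /= x Ux.
    have [_ W0 _ h] := SP _ (B0 0); rewrite -[x]addr0; exact: h.
  have [_ W0 _ h] := SP _ (UI n).
  by have [] := h _ _ Ux W0; rewrite addr0.
exists U => //; split.
- by case=> [|n] /=; [have [] := SP _ (B0 0)|have [] := SP _ (UI n)].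
- by case=> [|n] /=; [have [] := SP _ (B0 0)|have [] := SP _ (UI n)].
- by case=> [|n] /=; [have [] := SP _ (B0 0)|have [] := SP _ (UI n)].
- by move=> n x y Ux Uy; have [_ _ _ h] := SP _ (UI n); have [] := h _ _ Ux Uy.
- by move=> V /Bs[n nV]; exists n; apply: subset_trans nV; exact: UB.
Qed.

Lemma halving_base0 U : halving_base U -> base0 U.
Proof.
move=> h; split; last exact: hb_base h.
by move=> n; apply: open_nbhs_nbhs; split; [exact: hb_open h n|exact: hb_zero h n].
Qed.

Lemma cvg_nbhs0 (u : nat -> G) (l : G) :
  (forall V, nbhs 0 V -> exists N, forall n, (N <= n)%N -> V (u n - l)) ->
  u n @[n --> \oo] --> l.
Proof.
move=> h V /nbhs_shift/h[N NP]; exists N => // n /= Nn.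
by have := NP n Nn; rewrite /= addrC subrK.
Qed.

Definition gcauchy (u : nat -> G) : Prop :=
  forall V, nbhs 0 V -> exists N, forall m n,
    (N <= m)%N -> (N <= n)%N -> V (u m - u n).

Definition gcomplete : Prop :=
  forall u, gcauchy u -> exists l : G, u n @[n --> \oo] --> l.

Definition rapid (U : nat -> set G) (u : nat -> G) : Prop :=
  forall k, U k (u k.+1 - u k).

Section Halving.
Variables (U : nat -> set G) (hU : halving_base U).

Lemma hb_sub n x y : U n.+1 x -> U n.+1 y -> U n (x - y).
Proof. by move=> Ux /(hb_opp hU); exact: hb_add. Qed.

Lemma hb_leS n : U n.+1 `<=` U n.
Proof. by move=> x Ux; rewrite -[x]addr0; apply: hb_add => //; exact: hb_zero. Qed.

Lemma hb_le m n : (m <= n)%N -> U n `<=` U m.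
Proof.
elim: n => [|n IH]; first by rewrite leqn0 => /eqP ->.
rewrite leq_eqVlt => /orP[/eqP->//|/IH]; apply: subset_trans; exact: hb_leS.
Qed.

(* The telescoping steps are added from the right, so that each partial sum
   absorbs one halving. *)
Lemma chain_near (u : nat -> G) k j :
  (forall i, (k.+1 <= i < k.+1 + j)%N -> U i (u i.+1 - u i)) ->
  U k (u (k.+1 + j)%N - u k.+1).
Proof.
elim: j k => [|j IH] k h; first by rewrite addn0 subrr; exact: hb_zero.
have h1 : U k.+1 (u (k.+2 + j)%N - u k.+2).
  apply: IH => i /andP[ki ij]; apply: h.
  by rewrite (ltnW ki) /= (leq_trans ij) // addSnnS.
have h2 : U k.+1 (u k.+2 - u k.+1).
  by apply: h; rewrite leqnn /= -[X in (X < _)%N]addn0 ltn_add2l.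
by have := hb_add hU h1 h2; rewrite subrKA addSnnS.
Qed.

Lemma rapid_near u k n : rapid U u -> (k < n)%N -> U k (u n - u k.+1).
Proof. by move=> ru kn; rewrite -(subnKC kn); apply: chain_near => i _; exact: ru. Qed.

Lemma rapid_cauchy u : rapid U u -> gcauchy u.
Proof.
move=> ru V /(hb_base hU)[k kV]; exists k.+2 => m n km kn; apply: kV.
have := hb_sub (rapid_near ru km) (rapid_near ru kn).
by rewrite opprB addrA subrK.
Qed.

Lemma cvg_halving (u : nat -> G) (l : G) :
  (forall k, exists N, forall n, (N <= n)%N -> U k (u n - l)) ->
  u n @[n --> \oo] --> l.
Proof.
move=> h; apply: cvg_nbhs0 => V /(hb_base hU)[k kV].
by have [N NP] := h k; exists N => n /NP /kV.
Qed.

Lemma cvg_halvingP (u : nat -> G) (l : G) : u n @[n --> \oo] --> l ->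
  forall k, exists N, forall n, (N <= n)%N -> U k (u n - l).
Proof.
move=> ul k.
have : nbhs l [set y | U k (y - l)].
  apply/nbhs_shift; apply: filterS (proj1 (halving_base0 hU) k) => x /=.
  by rewrite addrC addKr.
by move=> /ul [N _ NP]; exists N => n Nn; apply: NP.
Qed.

Lemma cauchy_subseq u : gcauchy u ->
  exists2 s : nat -> nat, {homo s : m n / (m < n)%N} & rapid U (u \o s).
Proof.
move=> cu.
have /choice[N NP] : forall k, exists N, forall m n,
    (N <= m)%N -> (N <= n)%N -> U k (u m - u n).
  by move=> k; apply: cu; exact: (halving_base0 hU).1.
(* Adding [N n] and a successor makes [s] strictly increasing and at least [N n] at once. *)
pose s := fix s n := if n is m.+1 then (s m + N n).+1 else N 0.
have sS n : (s n < s n.+1)%N by rewrite /= ltnS leq_addr.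
have Ns n : (N n <= s n)%N by case: n => //= n; rewrite leqW// leq_addl.
exists s; first exact: homo_ltn ltn_trans sS.
by move=> k; apply: NP => //; apply: leq_trans (Ns k) _; exact: ltnW.
Qed.

Lemma cauchy_cvg_subseq u (s : nat -> nat) (l : G) :
  gcauchy u -> {homo s : m n / (m < n)%N} ->
  u (s n) @[n --> \oo] --> l -> u n @[n --> \oo] --> l.
Proof.
move=> cu ms sl; apply: cvg_halving => k.
have [N NP] := cu _ ((halving_base0 hU).1 k.+1).
have [M MP] := cvg_halvingP sl k.+1.
have ges n : (n <= s n)%N.
  by elim: n => // n IH; apply: leq_ltn_trans IH _; exact: ms.
exists N => n Nn.
have h1 := NP n (s (maxn N M)) Nn (leq_trans (leq_maxl _ _) (ges _)).
have h2 := MP _ (leq_maxr N M).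
by have := hb_add hU h1 h2; rewrite addrA subrK.
Qed.

(** Completeness need only be tested on sequences with controlled steps, the form in which it is
    verified for quotients and for [L0]. *)
Lemma gcomplete_rapid :
  (forall u, rapid U u -> exists l : G, u n @[n --> \oo] --> l) -> gcomplete.
Proof.
move=> h u cu; have [s ms rs] := cauchy_subseq cu.
by have [l sl] := h _ rs; exists l; exact: cauchy_cvg_subseq cu ms sl.
Qed.

End Halving.

End TopologicalGroup.

Lemma sub_morph0 (G H : zmodType) (f : G -> H) :
  {morph f : x y / x - y} -> f 0 = 0.
Proof. by move=> fB; rewrite -(subrr (0 : G)) fB subrr. Qed.

Lemma sub_morphD (G H : zmodType) (f : G -> H) :
  {morph f : x y / x - y} -> {morph f : x y / x + y}.
Proof.
by move=> fB x y; rewrite -[y in LHS]opprK fB -[- y]sub0r fB (sub_morph0 fB) sub0r opprK.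
Qed.

Lemma morphism_continuous (G H : preTopZmodType)
    (cG : continuous_sub G) (cH : continuous_sub H) (f : G -> H) :
  {morph f : x y / x - y} ->
  (forall V, nbhs 0 V -> nbhs 0 (f @^-1` V)) -> continuous f.
Proof.
move=> fB h x V /(nbhs_shift cH)/h/= Vx; apply/(nbhs_shift cG).
by apply: filterS Vx => u /=; rewrite (sub_morphD fB).
Qed.

(** Separation and density are phrased at 0, so that every clause can be checked on differences. The
    dense family is indexed by any countable type, since the constructions below produce pairs or
    finite sequences of indices. *)
Record complete_group (G : preTopZmodType) : Prop := CompleteGroup {
  cg_sub : continuous_sub G ;
  cg_base : exists B : nat -> set G, base0 B ;
  cg_sep : forall x : G, (forall V, nbhs 0 V -> V x) -> x = 0 ;
  cg_separable : exists (I : countType) (e : I -> G),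
    forall x V, nbhs 0 V -> exists i, V (e i - x) ;
  cg_complete : gcomplete G }.

Lemma cg_halving G : complete_group G -> exists U : nat -> set G, halving_base U.
Proof. by case=> cG [B hB] _ _ _; by have [U] := halving_base_exists cG hB; exists U. Qed.

Lemma countable_injection (T : Type) : countable [set: T] ->
  exists e : T -> nat, injective e.
Proof. by move=> /countable_injP[e einj]; exists e => x y; apply: einj; rewrite inE. Qed.

(** * Klee's theorem and metrization *)

Section Klee.
Variables (K : realType) (G : preTopZmodType) (pG : polish_group K G).

Let cG : continuous_sub G := pG.1.

Lemma metrizes_base0 (d : G -> G -> K) : metrizes d ->
  base0 (fun n => [set y | d 0 y < n.+1%:R^-1]).
Proof.
move=> [_ _ _ dN]; split.
  by move=> n; rewrite dN; exists n.+1%:R^-1 => //=; rewrite invr_gt0.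
move=> V; rewrite dN => -[e /= e0 eV].
have [n _ nE] := near_infty_natSinv_lt (PosNum e0).
by exists n => y /= yn; apply: eV => /=; apply: lt_trans yn _; exact: nE n (leqnn n).
Qed.

(* Klee: a Cauchy sequence [u] is split as [u (n k) = c k + c k.-1], where each
   [c k.+2 - c k] is a difference of terms of [u], made small with respect to
   [c k]; hence the even and the odd terms of [c] are Cauchy for any given
   complete metric, invariant or not. *)
Lemma polish_gcomplete : gcomplete G.
Proof.
have [_ [_ [d [d0 dC dT dN] dcomplete]]] := pG.
have [U hU _] := halving_base_exists cG (metrizes_base0 (And4 d0 dC dT dN)).
move=> u cu.
(* A state [(c, k, n)] holds the last summand, an index fixing how small later changes must be, and
   the last position used in [u]. The new [n] is chosen from the old [k], which determines the new
   [c]; the new [k] comes last, small enough for the metric at this [c]. *)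
pose R j (s s' : G * nat * nat) :=
  [/\ (s.1.2 < s'.1.2)%N, (s.2 < s'.2)%N, s'.1.1 = u s'.2 - s.1.1,
      forall m n, (s'.2 <= m)%N -> (s'.2 <= n)%N -> U s.1.2.+1 (u m - u n) &
      forall x, U s'.1.2 x -> d s'.1.1 (s'.1.1 + x) < j.+1%:R^-1].
have /choice[F FP] : forall js : nat * (G * nat * nat), exists s', R js.1 js.2 s'.
  move=> [j [[c k] n]]; rewrite /R /=.
  have [N NP] := cu _ ((halving_base0 hU).1 k.+1).
  pose n' := maxn N n.+1; pose c' := u n' - c.
  have : nbhs c' [set y | d c' y < j.+1%:R^-1].
    by rewrite dN; exists j.+1%:R^-1 => //=; rewrite invr_gt0.
  move=> /(nbhs_shift cG)/(hb_base hU)[p pP].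
  exists (c', maxn p k.+1, n') => /=; split => //.
  - by rewrite leq_maxr.
  - by rewrite leq_maxr.
  - by move=> m q mn qn; apply: NP; [apply: leq_trans mn|apply: leq_trans qn]; rewrite leq_maxl.
  - by move=> x Ux; apply: pP; apply: hb_le Ux => //; rewrite leq_maxl.
pose s := fix s j := if j is i.+1 then F (i, s i) else F (0%N, ((0 : G), 0%N, 0%N)).
have sP j : R j (s j) (s j.+1) by exact: FP (j, s j).
pose c j := (s j.+1).1.1; pose k j := (s j.+1).1.2; pose n j := (s j.+1).2.
have cS j : c j.+1 = u (n j.+1) - c j by have [] := sP j.+1.
have step j : U (k j).+1 (c j.+2 - c j).
  have -> : c j.+2 - c j = u (n j.+2) - u (n j.+1).
    by rewrite !cS opprB addrA addrAC addrK.
  have [_ _ _ h _] := sP j.+1; have [_ nn _ _ _] := sP j.+2.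
  by apply: h => //; exact: ltnW.
have kS j : (k j < k j.+1)%N by have [] := sP j.+1.
have far j i : U (k j) (c (j + i.*2)%N - c j).
  elim: i j => [|i IH] j; first by rewrite addn0 subrr; exact: hb_zero.
  have := IH j.+2; rewrite addSn addSn -!addnS -doubleS => h.
  have h' := hb_le hU (ltn_trans (kS j) (kS j.+1)) h.
  by have := hb_add hU h' (step j); rewrite subrKA.
have close j i : d (c j) (c (j + i.*2)%N) < j.+1%:R^-1.
  have [_ _ _ _ h] := sP j.
  by have := h _ (far j i); rewrite addrC subrK.
have cvgp (b : nat) : exists l : G, c (b + i.*2)%N @[i --> \oo] --> l.
  apply: dcomplete => e e0; have e20 : 0 < e / 2 by rewrite divr_gt0.
  have [N _ NE] := near_infty_natSinv_lt (PosNum e20).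
  have NN : (N <= b + N.*2)%N by rewrite -addnn addnA leq_addl.
  have NP m : (N <= m)%N -> d (c (b + N.*2)%N) (c (b + m.*2)%N) < e / 2.
    move=> Nm; apply: lt_trans (NE _ NN).
    by have := close (b + N.*2)%N (m - N)%N; rewrite -addnA -doubleD subnKC.
  exists N => p q Np Nq; apply: le_lt_trans (dT _ (c (b + N.*2)%N) _) _.
  by rewrite [e]splitr dC ltrD// NP.
have [a ca] := cvgp 0%N; have [b cb] := cvgp 1%N.
(* Consecutive summands add up to a term of [u], so the even and the odd limits add up to the limit
   of a subsequence of [u]. *)
exists (a + b).
apply: (@cauchy_cvg_subseq _ cG _ hU _ (fun i => n i.*2.+1)) => //.
  apply: homo_ltn; first exact: ltn_trans.
  by move=> i; have [_ h1 _ _ _] := sP i.*2.+2; have [_ h2 _ _ _] := sP i.*2.+3; exact: ltn_trans h1 h2.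
rewrite (_ : (fun i => u (n i.*2.+1)) = (fun i => c (0 + i.*2)%N + c (1 + i.*2)%N)).
  exact: (cvg_add cG _ ca cb).
by apply/funext => i; rewrite add0n add1n cS addrC subrK.
Qed.

Lemma polish_complete_group : complete_group G.
Proof.
have [_ [[D cD dD] [d [d0 dC dT dN] _]]] := pG.
split.
- exact: cG.
- by exists (fun n => [set y | d 0 y < n.+1%:R^-1]); exact: metrizes_base0 (And4 d0 dC dT dN).
- move=> x h; apply/esym/d0; apply/eqP; rewrite eq_le; apply/andP; split.
    rewrite leNgt; apply/negP => dx.
    have : nbhs 0 [set y | d 0 y < d 0 x] by rewrite dN; exists (d 0 x).
    by move=> /h /=; rewrite ltxx.
  have := dT 0 x 0; rewrite (dC x) (_ : d 0 0 = 0); last exact/d0.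
  by rewrite -mulr2n pmulrn_lge0.
- have [e De] : exists e : nat -> G, D `<=` range e.
    move/pfcard_geP : cD => [->|[e]]; first by exists (fun=> 0).
    by exists e => x Dx; have [n _ <-] := @surj _ _ _ _ e x Dx; exists n.
  exists nat, e => x V V0.
  have : nbhs x [set y | V (y - x)].
    by apply/(nbhs_shift cG); apply: filterS V0 => y /=; rewrite addrC addKr.
  rewrite nbhsE => -[W [oW Wx] WV].
  have [y [Wy Dy]] := dD W (ex_intro _ x Wx) oW.
  by have [n _ ny] := De _ Dy; exists n; rewrite ny; exact: WV.
- exact: polish_gcomplete.
Qed.

End Klee.

(** * The group uniformity and metrization *)

Section GroupUniformity.
Variables (G : preTopZmodType) (U : nat -> set G) (hU : halving_base U).

(** An alias of [G] that remembers [hU]: the uniformity is defined from the chosen halving base, and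
    the given topology of [G] stays untouched. *)
Definition group_uniform : Type := let _ := hU in G.

HB.instance Definition _ := Choice.on group_uniform.

Let ent : set_system (group_uniform * group_uniform) :=
  filter_from setT (fun k => [set xy | U k (xy.2 - xy.1 : G)]).

Let ent_filter : Filter ent.
Proof.
apply: filter_from_filter; first by exists 0%N.
move=> i j _ _; exists (maxn i j) => // -[x y] /= Uxy.
by split => /=; apply: hb_le Uxy => //; rewrite ?leq_maxl ?leq_maxr.
Qed.
Let ent_refl A : ent A -> diagonal `<=` A.
Proof.
by move=> [k _ kA] [x y] /diagonalP ->; apply: kA; rewrite /= subrr; exact: hb_zero.
Qed.
Let ent_inv A : ent A -> ent A^-1%relation.
Proof.
move=> [k _ kA]; exists k => // -[x y] /= Uxy; apply: kA => /=.
by rewrite -opprB; exact: hb_opp.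
Qed.
Let ent_split A : ent A -> exists2 B, ent B & (B \; B)%relation `<=` A.
Proof.
move=> [k _ kA]; exists [set xy | U k.+1 (xy.2 - xy.1 : G)]; first by exists k.+1.
move=> [x y] [z /= xz zy]; apply: kA => /=.
by have := hb_add hU zy xz; rewrite addrA subrK.
Qed.

HB.instance Definition _ := isUniform.Build group_uniform
  ent_filter ent_refl ent_inv ent_split.

Lemma group_entourageE (A : set (group_uniform * group_uniform)) :
  entourage A <-> exists k, forall x y : G, U k (y - x) -> A (x, y).
Proof.
split=> [[k _ kA]|[k kA]]; first by exists k => x y Uxy; exact: kA.
by exists k => // -[x y]; exact: kA.
Qed.

Lemma group_countable_uniformity : countable_uniformity group_uniform.
Proof.
apply/countable_uniformityP; exists (fun k => [set xy | U k (xy.2 - xy.1 : G)]).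
  by move=> A [k _ kA]; exists k.
by move=> k; exists k.
Qed.

End GroupUniformity.

Section Metrization.
Variables (K : realType) (G : preTopZmodType).

Lemma complete_group_polish : complete_group G -> polish_group K G.
Proof.
move=> cpG; have cG := cg_sub cpG; split=> //.
have [U hU] := cg_halving cpG.
pose T : pseudoMetricType K := countable_uniform (group_countable_uniformity hU).
pose bl (x : G) (e : K) (y : G) : Prop := @ball K T x e y.
have entT : @entourage (group_uniform hU) = @entourage T by [].
have blU k : exists2 e : K, 0 < e & forall x y, bl x e y -> U k (y - x).
  have : @entourage T [set xy | U k ((xy.2 : G) - (xy.1 : G))].
    by rewrite -entT; apply/group_entourageE; exists k.
  by rewrite -entourage_ballE => -[e /= e0 eU]; exists e => // x y xy; exact: (eU (x, y)).
have Ubl (e : K) : 0 < e -> exists k, forall x y, U k (y - x) -> bl x e y.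
  move=> e0; have : @entourage T [set xy | ball xy.1 e xy.2].
    by rewrite -entourage_ballE; exists e.
  by rewrite -entT => /group_entourageE.
(* Only the relation [ball] comes with [T]; the distance is recovered as the infimum of the
   admissible radii, a nonempty set because any two points are within 2. *)
pose S (x y : G) : set K := [set e : K | 0 < e /\ bl x e y].
have S2 x y : S x y 2 by split => //; exact: countable_uniform.countable_uniform_bounded.
have infS x y : has_inf (S x y).
  by split; [exists 2|exists 0 => e [/ltW]].
pose d x y := inf (S x y).
have dball x y (e : K) : d x y < e -> bl x e y.
  move=> dxy; have [e' [e'0 xye'] e'e] := inf_lt (infS x y).1 dxy.
  exact: (@le_ball K T x _ _ (ltW e'e)).
have balld x y (e : K) : 0 < e -> bl x e y -> d x y <= e.
  by move=> e0 xy; apply: ge_inf; [exact: (infS x y).2|split].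
have d_ge0 x y : 0 <= d x y.
  by apply: lb_le_inf; [exists 2; exact: S2|move=> e [/ltW]].
have nbhsd x : nbhs x = filter_from [set e : K | 0 < e] (fun e => [set y | d x y < e]).
  rewrite predeqE => V; split.
    move=> /(nbhs_shift cG)/(hb_base hU)[k kV]; have [e e0 eU] := blU k.
    by exists e => // y /= /dball/eU/kV /=; rewrite addrC subrK.
  move=> [e /= e0 eV]; have e20 : 0 < e / 2 by rewrite divr_gt0.
  have [k kP] := Ubl _ e20.
  apply/(nbhs_shift cG); apply: filterS ((halving_base0 hU).1 k) => u Uu.
  apply: eV => /=; apply: (@le_lt_trans _ _ (e / 2)).
    by apply: balld => //; apply: kP; rewrite addrC addKr.
  by rewrite ltr_pdivrMr// ltr_pMr// ltr1n.
split.
  have [I [e he]] := cg_separable cpG.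
  exists (range e); first exact: (card_le_trans (card_image_le _ _) (countableP _)).
  move=> O [x Ox] oO.
  have /(nbhs_shift cG)/he : nbhs x O by exact: open_nbhs_nbhs.
  by move=> /(_ x)[i /=]; rewrite addrC subrK => Oi; exists (e i); split => //; exists i.
exists d; first split => //.
- move=> x y; split => [dxy|->].
    apply/eqP; rewrite eq_sym -subr_eq0; apply/eqP; apply: (cg_sep cpG).
    move=> V /(hb_base hU)[k]; apply; have [e e0] := blU k; apply.
    by apply: dball; rewrite dxy.
  apply/eqP; rewrite eq_le d_ge0 andbT; apply/ler_addgt0Pl => e e0.
  by rewrite addr0; apply: balld => //; exact: (@ball_center K T y (PosNum e0)).
- move=> x y; congr inf; rewrite predeqE => e.
  by split => -[e0 xy]; split => //; exact: (@ball_sym K T).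
- move=> x y z; apply/ler_addgt0Pl => e e0; have e20 : 0 < e / 2 by rewrite divr_gt0.
  rewrite [e]splitr addrC addrACA; apply: balld.
    by rewrite addr_gt0// ltr_wpDl// d_ge0.
  by apply: (@ball_triangle K T y); apply: dball; rewrite ltrDl.
- move=> u cu; apply: (cg_complete cpG) => V /(hb_base hU)[k kV].
  have [e e0 eU] := blU k; have [N NP] := cu _ e0.
  by exists N => m n Nm Nn; apply/kV/eU/dball; exact: NP.
Qed.

(** Carries a Polish structure to a topology whose open sets are those with open preimage, as in
    [transport]; the metric is moved by the inverse map. *)
Lemma polish_group_transport (H : preTopZmodType) (f : G -> H) :
  {morph f : x y / x - y} -> bijective f ->
  (forall V : set H, open V <-> open (f @^-1` V)) ->
  polish_group K G -> polish_group K H.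
Proof.
move=> fB [g fK gK] fo [cG [[D cD dD] [d [d0 dC dT dN] dc]]].
have cf : continuous f by apply/continuousP => V /fo.
have cg : continuous g.
  apply/continuousP => V oV; apply/fo; rewrite (_ : _ @^-1` _ = V)//.
  by rewrite predeqE => x; rewrite /= fK.
split.
  move=> [x y] /= V; rewrite -[x]gK -[y]gK -fB => /cf Vf.
  have [[P Q] /= [Px Qy] PQ] := @cG (g x, g y) _ Vf.
  exists (g @^-1` P, g @^-1` Q) => /=; first by rewrite !gK; split; exact: cg.
  by move=> [a b] /= [Pa Qb]; have := PQ (g a, g b) (conj Pa Qb); rewrite /= fB !gK.
split.
  exists (f @` D); first exact: card_le_trans (card_image_le f D) cD.
  move=> O [x Ox] oO.
  have [|y [Oy Dy]] := dD (f @^-1` O) _ ((fo O).1 oO).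
    by exists (g x); rewrite /= gK.
  by exists (f y); split => //; exists y.
exists (fun x y => d (g x) (g y)); first split => //.
- by move=> x y; rewrite d0; split => [|->//]; exact: (can_inj gK).
- move=> x; rewrite predeqE => V; split.
    rewrite -[x in nbhs x]gK => /cf Vf.
    have : nbhs (g x) (f @^-1` V) by exact: Vf.
    rewrite dN => -[e /= e0 eV]; exists e => // y /= xy.
    by have := eV _ xy; rewrite /= gK.
  move=> [e /= e0 eV].
  have : nbhs (g x) [set y | d (g x) y < e] by rewrite dN; exists e.
  by move=> /cg h; apply: (@filterS _ (nbhs x) _ _ _ _ h) => y /= /eV.
- move=> u cu; have [l ul] := dc (g \o u) cu; exists (f l).
  have -> : u = f \o (g \o u) by apply/funext => n /=; rewrite gK.
  exact: (cvg_comp _ _ ul (cf l)).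
Qed.

End Metrization.

(** * Products, closed subgroups and quotients *)

Lemma complete_group_pair (G H : preTopZmodType) :
  complete_group G -> complete_group H -> complete_group (G * H)%type.
Proof.
move=> cpG cpH; have cG := cg_sub cpG; have cH := cg_sub cpH.
have [U hU] := cg_halving cpG; have [V hV] := cg_halving cpH.
have [U0 Ub] := halving_base0 hU; have [V0 Vb] := halving_base0 hV.
have [I [e eI]] := cg_separable cpG; have [J [f fJ]] := cg_separable cpH.
have n0 (P : set G) (Q : set H) : nbhs 0 P -> nbhs 0 Q ->
  nbhs (0 : G * H) (P `*` Q) by exists (P, Q).
split.
- move=> [[a b] [a' b']] /= W [[P Q] /= [Pa Qb] PQ].
  have /= [[P1 P2] /= [P1a P2a] P12] := @cG (a, a') _ Pa.
  have /= [[Q1 Q2] /= [Q1b Q2b] Q12] := @cH (b, b') _ Qb.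
  exists (P1 `*` Q1, P2 `*` Q2) => /=; first by split; [exists (P1, Q1)|exists (P2, Q2)].
  move=> [[x y] [x' y']] /= [[Px Qy] [Px' Qy']]; apply: PQ; split => /=.
    exact: (P12 (x, x')).
  exact: (Q12 (y, y')).
- exists (fun n => U n `*` V n); split; first by move=> n; exact: n0.
  move=> W [[P Q] /= [P0 Q0] PQ].
  have [m mP] := Ub _ P0; have [n nQ] := Vb _ Q0.
  exists (maxn m n) => -[x y] [/= Ux Vy]; apply: PQ; split => /=.
    by apply: mP; apply: hb_le Ux => //; exact: leq_maxl.
  by apply: nQ; apply: hb_le Vy => //; exact: leq_maxr.
- move=> [x y] h; congr (_, _).
    by apply: (cg_sep cpG) => P P0; have [] := h _ (n0 P setT P0 filterT).
  by apply: (cg_sep cpH) => P P0; have [] := h _ (n0 setT P filterT P0).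
- exists (I * J)%type, (fun ij => (e ij.1, f ij.2)) => -[x y] W [[P Q] /= [P0 Q0] PQ].
  have [i iP] := eI x _ P0; have [j jQ] := fJ y _ Q0.
  by exists (i, j); exact: (PQ (_, _)).
- move=> u cu.
  have [|a ua] := cg_complete cpG (u := fst \o u).
    move=> P P0; have [N NP] := cu _ (n0 P setT P0 filterT).
    by exists N => m n Nm Nn; have [] := NP m n Nm Nn.
  have [|b ub] := cg_complete cpH (u := snd \o u).
    move=> P P0; have [N NP] := cu _ (n0 setT P filterT P0).
    by exists N => m n Nm Nn; have [] := NP m n Nm Nn.
  exists (a, b); have -> : u = (fun n => ((fst \o u) n, (snd \o u) n)).
    by apply/funext => n /=; case: (u n).
  exact: cvg_pair.
Qed.

(** * Countable powers with pointwise convergence *)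

Section Power.
Variables (I : Type) (G : preTopZmodType).

Let P : preTopZmodType := {ptws I -> G}.

Lemma ptws_eval_continuous (i : I) : continuous (fun f : P => f i).
Proof. exact: (@proj_continuous {classic I} (fun=> G) i). Qed.

Lemma ptws_cvg (F : set_system P) (FF : Filter F) (x : P) :
  (forall i, f i @[f --> F] --> x i) -> F --> x.
Proof.
move=> h; apply/cvg_sup => i A [_ [[W oW <-] /= Wx] WA].
have : F [set f : P | W (f i)] by apply: h; exact: open_nbhs_nbhs.
exact: filterS.
Qed.

Lemma ptws_continuous (T : topologicalType) (f : T -> P) :
  (forall i, continuous (fun t => f t i)) -> continuous f.
Proof. by move=> h t; apply: ptws_cvg => i; exact: h. Qed.

Lemma complete_group_ptws : countable [set: I] -> complete_group G -> complete_group P.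
Proof.
move=> cI cpG; have [r r_inj] := countable_injection cI.
have cG := cg_sub cpG; have [U hU] := cg_halving cpG; have [U0 Ub] := halving_base0 hU.
have [J [e eJ]] := cg_separable cpG.
(* One index governs both how many coordinates are constrained, in the numbering [r], and how
   strongly. *)
pose B n : set P := [set f | forall i, (r i < n)%N -> U n (f i)].
have B0 n : nbhs 0 (B n).
  have {}B0 m : nbhs (0 : P) [set f : P | forall i, (r i < m)%N -> U n (f i)].
    elim: m => [|m IH]; first by apply: filterS filterT => f _ i.
    have [[i rim]|ni] := pselect (exists i, r i = m).
      have Ui : nbhs (0 : P) [set f : P | U n (f i)].
        by apply: ptws_eval_continuous; exact: U0.
      apply: filterS (filterI IH Ui) => f [h fi] j; rewrite ltnS leq_eqVlt.
      by move=> /orP[/eqP|/h//]; rewrite -rim => /r_inj ->.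
    apply: filterS IH => f h j; rewrite ltnS leq_eqVlt => /orP[/eqP rj|/h//].
    by case: ni; exists j.
  exact: B0.
have Bb (V : set P) : nbhs 0 V -> exists n, B n `<=` V.
  (* The sets [B n] generate a filter that converges to 0 in each coordinate, hence in the product;
     the basic open sets of the product need not be described. *)
  move=> V0; pose F : set_system P := filter_from setT B.
  have FF : Filter F.
    apply: filter_from_filter; first by exists 0%N.
    move=> m n _ _; exists (maxn m n) => // f h.
    split=> i ri.
      by apply/(hb_le hU (leq_maxl m n))/h; rewrite (leq_trans ri)// leq_maxl.
    by apply/(hb_le hU (leq_maxr m n))/h; rewrite (leq_trans ri)// leq_maxr.
  have /(_ _ V0)[n _ nV] : F --> (0 : P); last by exists n.
  apply: ptws_cvg => i W /Ub[n nW]; exists (maxn n (r i).+1) => // f h.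
  exact/nW/(hb_le hU (leq_maxl n (r i).+1))/h/leq_maxr.
split.
- apply: ptws_continuous => i [x y].
  apply: (@cvg_sub _ cG _ _ _ (fun z : P * P => z.1 i) (fun z : P * P => z.2 i)).
    move=> V Vx; exists ([set f | V (f i)], setT); last by move=> [f g] [].
    by split; [exact: (@ptws_eval_continuous i x)|exact: filterT].
  move=> V Vy; exists (setT, [set f | V (f i)]); last by move=> [f g] [].
  by split; [exact: filterT|exact: (@ptws_eval_continuous i y)].
- by exists B.
- move=> x h; apply/funext => i; apply: (cg_sep cpG) => V V0.
  by apply: (h [set f : P | V (f i)]); exact: ptws_eval_continuous.
(* Only the first [n] coordinates matter for [B n], so finite sequences of approximants suffice;
   missing entries give the coordinate 0. *)
- exists (seq (option J)), (fun s i => if nth None s (r i) is Some j then e j else 0) => x V /Bb[n nV].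
  have /choice[p pP] : forall m, exists j, forall i, r i = m -> U n (e j - x i).
    move=> m; have [[i rim]|ni] := pselect (exists i, r i = m).
      by have [j jP] := eJ (x i) _ (U0 n); exists j => i' ri'; rewrite (r_inj i' i)// ri'.
    have [j _] := eJ 0 _ (U0 0%N).
    by exists j => i ri; case: ni; exists i.
  exists (mkseq (Some \o p) n); apply: nV => i rin.
  by rewrite -[X in U n X]/(_ - _) nth_mkseq//=; exact: pP.
- move=> u cu.
  have /choice[l lP] : forall i, exists l : G, u n i @[n --> \oo] --> l.
    move=> i; apply: (cg_complete cpG) => V V0.
    exact: (cu [set f : P | V (f i)] (ptws_eval_continuous V0)).
  by exists l; apply: ptws_cvg => i; exact: lP.
Qed.

End Power.

(** * Closed subgroups and quotients *)

Section SubgroupQuotient.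
Variable G : preTopZmodType.

Section Subgroup.
Variables (H : set G) (HH : is_subgroup H).

Lemma nbhs_subgroup (x : subgroup_type HH) (V : set (subgroup_type HH)) :
  nbhs x V <-> exists2 W : set G, nbhs (val x : G) W & forall y : subgroup_type HH, W (val y) -> V y.
Proof.
rewrite nbhsE; split=> [[_ [[W oW <-] /= Wx] WV]|[W]].
  by exists W => //; exact: open_nbhs_nbhs.
rewrite nbhsE => -[W' [oW' W'x] W'W WV].
exists (val @^-1` W'); first by split => //; exists W'.
by move=> y /= /W'W /WV.
Qed.

Lemma subgroup_valD : {morph (val : subgroup_type HH -> G) : x y / x + y}.
Proof. by move=> x y; rewrite -[LHS]/(val x - (0 - val y)) sub0r opprK. Qed.

Lemma subgroup_valB : {morph (val : subgroup_type HH -> G) : x y / x - y}.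
Proof.
by move=> x y; apply: (addIr (val y)); rewrite -subgroup_valD !subrK.
Qed.

Lemma subgroup_val_continuous : continuous (val : subgroup_type HH -> G).
Proof. by move=> x V Vx; apply/nbhs_subgroup; exists V. Qed.

Lemma complete_group_subgroup : complete_group G -> closed H ->
  complete_group (subgroup_type HH).
Proof.
move=> cpG clH; have cG := cg_sub cpG.
have [U hU] := cg_halving cpG; have [U0 Ub] := halving_base0 hU.
have [J [e eJ]] := cg_separable cpG.
split.
- move=> [x y] V /nbhs_subgroup[W]; rewrite subgroup_valB => nW WV.
  have [[P Q] /= [Px Qy] PQ] := @cG (val x, val y) _ nW.
  exists (val @^-1` P, val @^-1` Q).
    by split; apply: subgroup_val_continuous.
  by move=> [a b] /= [Pa Qb]; apply: WV; rewrite subgroup_valB; exact: (PQ (_, _)).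
- exists (fun n => val @^-1` U n); split.
    by move=> n; apply: subgroup_val_continuous; exact: U0.
  by move=> V /nbhs_subgroup[W /Ub[n nW] WV]; exists n => x /nW /WV.
- move=> x h; apply: val_inj; apply: (cg_sep cpG) => V V0.
  by apply: (h (val @^-1` V)); exact: subgroup_val_continuous.
(* The approximants [e j] need not lie in [H]: each is replaced by a point of [H] in its [n]-th
   neighbourhood when there is one, and by 0 otherwise. Passing through [e j] costs one halving,
   whence [n.+1] below. *)
- have /choice[p pP] : forall jn : J * nat, exists y : subgroup_type HH,
      (exists z : subgroup_type HH, U jn.2 (val z - e jn.1)) -> U jn.2 (val y - e jn.1).
    move=> jn; have [[z zP]|nz] := pselect (exists z : subgroup_type HH,
      U jn.2 (val z - e jn.1)); by [exists z|exists 0].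
  exists (J * nat)%type, p => x V /nbhs_subgroup[W /Ub[n nW] WV].
  have [j jP] := eJ (val x) _ (U0 n.+1).
  exists (j, n.+1); apply: WV; apply: nW.
  rewrite subgroup_valB; have := pP (j, n.+1) (ex_intro _ x _) => /=.
  rewrite -opprB => /(_ (hb_opp hU jP)) h.
  by have := hb_add hU h jP; rewrite addrA subrK.
- move=> u cu.
  have [|l ul] := cg_complete cpG (u := val \o u).
    move=> V V0; have [M MP] := cu (val @^-1` V) (@subgroup_val_continuous 0 _ V0).
    by exists M => m n Mm Mn; rewrite /comp -subgroup_valB; exact: MP.
  have Hl : H l.
    apply: clH => W Wl; have [N _ NP] := ul _ Wl.
    by exists (val (u N)); split; [exact: set_mem (valP (u N))|exact: NP N (leqnn N)].
  exists (exist _ l (mem_set Hl) : subgroup_type HH) => V /nbhs_subgroup[W Wl WV].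
  have [N _ NP] := ul _ Wl.
  by exists N => // n Nn; apply: WV; exact: NP.
Qed.

End Subgroup.

Section Quotient.
Variables (N : set G) (HN : is_subgroup N).
Local Notation pi := (coset_pi HN).

Lemma coset_piP x y : pi x = pi y <-> N (x - y).
Proof. by split => [/eqmodP/asboolP//|?]; apply/eqmodP/asboolP. Qed.

Lemma coset_pi_surj (q : quot_group HN) : exists x, q = pi x.
Proof. by exists (repr q); rewrite /coset_pi reprK. Qed.

Lemma subgroupN x : N x -> N (- x).
Proof. by move=> Nx; rewrite -sub0r; apply: HN.2 => //; exact: HN.1. Qed.

Lemma subgroupD x y : N x -> N y -> N (x + y).
Proof. by move=> Nx /subgroupN Ny; rewrite -[y]opprK; exact: HN.2. Qed.

Lemma coset_piD : {morph pi : x y / x + y}.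
Proof.
have reprP (x : G) : N (repr (pi x) - x) by apply/coset_piP; rewrite /coset_pi reprK.
move=> x y; apply/esym/coset_piP; rewrite opprD addrACA.
by apply: subgroupD; exact: reprP.
Qed.

Lemma coset_pi0 : pi 0 = 0. Proof. by []. Qed.

Lemma coset_piB : {morph pi : x y / x - y}.
Proof.
move=> x y; apply: (addIr (pi y)).
by rewrite -coset_piD !subrK.
Qed.

Lemma coset_piN : {morph pi : x / - x}.
Proof. by move=> x; rewrite -[LHS]/(pi (- x)) -sub0r coset_piB coset_pi0 sub0r. Qed.

Lemma coset_pi_continuous : continuous pi.
Proof. exact: pi_continuous. Qed.

Hypothesis cG : continuous_sub G.

(** Translation by elements of [N] shows that the saturation of an open set is open. *)
Lemma coset_pi_open (U : set G) : open U -> open (pi @` U).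
Proof.
move=> oU; rewrite /open /= /quotient_open openE => x [y Uy].
move=> /coset_piP Nyx; rewrite /interior; apply/(nbhs_shift cG).
have : nbhs y U by exact: open_nbhs_nbhs.
move=> /(nbhs_shift cG); apply: filterS => u /= Uyu; exists (y + u) => //.
by apply/coset_piP; rewrite opprD addrACA subrr addr0.
Qed.

Lemma nbhs_coset_pi x (V : set (quot_group HN)) : nbhs (pi x) V <-> nbhs x (pi @^-1` V).
Proof.
split; first exact: coset_pi_continuous.
rewrite nbhsE => -[W [oW Wx] WV]; rewrite nbhsE; exists (pi @` W).
  by split; [exact: coset_pi_open|exists x].
by move=> _ [y /WV Vy <-].
Qed.

Lemma quot_continuous_sub : continuous_sub (quot_group HN).
Proof.
move=> [q q'] V; have [x ->] := coset_pi_surj q; have [y ->] := coset_pi_surj q'.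
rewrite /= -coset_piB => /nbhs_coset_pi h.
have [[P Q] /= [Px Qy] PQ] := @cG (x, y) _ h.
exists (pi @` P, pi @` Q) => /=.
  by split; apply/nbhs_coset_pi; [move: Px|move: Qy]; apply: filterS => z ?; exists z.
by move=> [_ _] [/= [a Pa <-] [b Qb <-]]; rewrite -coset_piB; exact: (PQ (a, b)).
Qed.

(** Closedness of [N] separates the points of the quotient. For completeness, each small step
    between cosets has a representative in [U k]; adding up these representatives lifts the sequence
    to a rapid one in [G], whose limit projects to the required limit. *)
Lemma complete_group_quot : complete_group G -> closed N -> complete_group (quot_group HN).
Proof.
move=> cpG clN; have [U hU] := cg_halving cpG; have [U0 Ub] := halving_base0 hU.
have hQ : halving_base (fun k => pi @` U k).
  split.
  - by move=> n; apply: coset_pi_open; exact: hb_open hU n.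
  - by move=> n; exists 0 => //; exact: hb_zero.
  - by move=> n _ [x Ux <-]; exists (- x); [exact: hb_opp|exact: coset_piN].
  - by move=> n _ _ [x Ux <-] [y Uy <-]; exists (x + y); [exact: hb_add|exact: coset_piD].
  - by move=> V /nbhs_coset_pi /Ub[n nV]; exists n => _ [x /nV Vx <-].
have cQ := quot_continuous_sub.
split => //.
- by exists (fun k => pi @` U k); exact: halving_base0.
- move=> q; have [x ->] := coset_pi_surj q => h; apply/coset_piP; rewrite subr0.
  apply: clN => W /(nbhs_shift cG)/Ub[n nW].
  have [y Uy /coset_piP Nyx] := h _ ((halving_base0 hQ).1 n).
  exists (x - y); split; first by rewrite -opprB; exact: subgroupN.
  by apply: nW; exact: hb_opp.
- have [J [e eJ]] := cg_separable cpG; exists J, (pi \o e) => q V.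
  have [x ->] := coset_pi_surj q => /nbhs_coset_pi/eJ => /(_ x)[j jV].
  by exists j; rewrite /= -coset_piB.
- apply: (gcomplete_rapid cQ hQ) => v rv.
  have /choice[w wP] : forall k, exists w, U k w /\ v k.+1 = v k + pi w.
    by move=> k; have [w Uw wE] := rv k; exists w; split; rewrite // wE addrC subrK.
  pose x := fix x k := if k is j.+1 then x j + w j else repr (v 0%N).
  have vx k : v k = pi (x k).
    by elim: k => [|k IH]; [rewrite /coset_pi reprK|rewrite (wP k).2 IH /= coset_piD].
  have rx : rapid U x by move=> k; rewrite /= addrC addKr; exact: (wP k).1.
  have [l xl] := cg_complete cpG (rapid_cauchy hU rx).
  exists (pi l); rewrite (funext vx).
  exact: (cvg_comp _ _ xl (@coset_pi_continuous l)).
Qed.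

End Quotient.

End SubgroupQuotient.

(** * Convergence in measure *)

Section FiniteMeasure.
Context d (T : measurableType d) (K : realType) (mu : {measure set T -> \bar K}).

Lemma ae_imp (P Q : T -> Prop) : {ae mu, forall x, P x} ->
  (forall x, P x -> Q x) -> {ae mu, forall x, Q x}.
Proof. by move=> + PQ; exact: (@filterS _ _ (ae_filter_ringOfSetsType mu)). Qed.

Lemma ae_and (P Q : T -> Prop) : {ae mu, forall x, P x} ->
  {ae mu, forall x, Q x} -> {ae mu, forall x, P x /\ Q x}.
Proof. exact: (@filterI _ _ (ae_filter_ringOfSetsType mu)). Qed.

Lemma ae_le_measure (B C : set T) : measurable B -> measurable C ->
  {ae mu, forall x, B x -> C x} -> (mu B <= mu C)%E.
Proof.
move=> mB mC [N [mN N0 BCN]].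
apply: (@le_trans _ _ (mu (C `|` N))).
  apply: le_measure; rewrite ?inE//; first exact: measurableU.
  move=> x Bx; have [Cx|nCx] := pselect (C x); first by left.
  by right; apply: BCN => /(_ Bx).
by rewrite -[leRHS]adde0 -N0; exact: measureU2.
Qed.

Lemma measure_tail_half (F : nat -> set T) : (forall k, measurable (F k)) ->
  (forall k, (mu (F k) <= (2^-1 ^+ k.+1)%:E)%E) ->
  forall k, (mu (\bigcup_(j >= k) F j) <= (2^-1 ^+ k)%:E)%E.
Proof.
move=> mF Fle k.
have h : (mu (\bigcup_(j >= k) F j) <= \sum_(k <= n <oo) mu (F n))%E.
  apply: measure_sigma_subadditive_tail => //; first exact: bigcup_measurable.
  by move=> x [j /= kj Fj]; exists j => //=; apply/negP; rewrite -leqNgt.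
apply: (le_trans h); apply: lime_le; first exact: is_cvg_nneseries.
apply: nearW => n; rewrite -[leRHS]adde0.
(* Each bound [2^-1 ^+ i.+1] is written as [2^-1 ^+ i - 2^-1 ^+ i.+1], so that the finite sums
   telescope to at most [2^-1 ^+ k]. *)
apply: (@le_trans _ _ (\sum_(k <= i < n) (2^-1 ^+ i - 2^-1 ^+ i.+1)%:E)%E).
  apply: lee_sum => i _; apply: le_trans (Fle i) _; rewrite lee_fin.
  by rewrite lerBrDr exprS -mulrDl -[2^-1]div1r -splitr !mul1r.
rewrite sumEFin adde0 lee_fin; have [nk|kn] := leqP n k.
  by rewrite big_geq// exprn_ge0.
have := telescope_sumr (fun i => - 2^-1 ^+ i : K) (ltnW kn).
under eq_bigr do rewrite opprK addrC.
by move=> ->; rewrite opprK addrC gerBl exprn_ge0.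
Qed.

Lemma half_lt (e : K) : 0 < e -> exists k, 2^-1 ^+ k < e.
Proof.
move=> e0; have [k _ kE] := near_infty_natSinv_lt (PosNum e0).
exists k.+1; apply: le_lt_trans (kE k (leqnn k)) => /=.
rewrite exprVn lef_pV2 ?posrE ?exprn_gt0// -natrX ler_nat.
exact: ltnW (ltn_expl _ _).
Qed.

(** Borel-Cantelli: the limsup lies in every tail, and the tail from [k] has measure at most
    [2^-1 ^+ k]. *)
Lemma null_tail (F : nat -> set T) : (forall k, measurable (F k)) ->
  (forall k, (mu (F k) <= (2^-1 ^+ k.+1)%:E)%E) ->
  mu (\bigcap_k \bigcup_(j >= k) F j) = 0.
Proof.
move=> mF Fle; apply/eqP; rewrite eq_le measure_ge0 andbT.
apply/lee_addgt0Pr => e e0; rewrite add0e.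
have [k ke] := half_lt e0.
apply: le_trans (le_trans (measure_tail_half mF Fle k) _); last by rewrite lee_fin ltW.
apply: le_measure; rewrite ?inE.
- by apply: bigcapT_measurable => i; exact: bigcup_measurable.
- exact: bigcup_measurable.
- by move=> x; apply.
Qed.

Lemma measure_exhaust (muT : (mu setT < +oo)%E) (F : nat -> set T) (E : set T) :
  (forall k, measurable (F k)) -> nondecreasing_seq F -> E = \bigcup_k F k ->
  forall e : K, 0 < e -> exists k, (mu (E `\` F k) < e%:E)%E.
Proof.
move=> mF ndF EF e e0.
have mE : measurable E by rewrite EF; exact: bigcup_measurable.
have mD k : measurable (E `\` F k) by exact: measurableD.
have D0 : \bigcap_k (E `\` F k) = set0.
  rewrite -subset0 => x Dx; have [+ _] := Dx 0%N I.
  by rewrite EF => -[k _ Fx]; have [_ /(_ Fx)] := Dx k I.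
have : mu (E `\` F k) @[k --> \oo] --> mu (\bigcap_k (E `\` F k)).
  apply: nonincreasing_cvg_mu => //.
  - by apply: le_lt_trans muT; apply: le_measure; rewrite ?inE.
  - exact: bigcapT_measurable.
  - by move=> m n mn; apply/subsetPset; apply: setDS; exact/subsetPset/ndF.
rewrite D0 measure0 => /(_ [set y | y < e%:E]%E)[|k _ kP].
  by apply: open_nbhs_nbhs; split; [exact: open_ereal_lt_ereal|rewrite /= lte_fin].
by exists k; exact: kP k (leqnn k).
Qed.

End FiniteMeasure.

Section L0Group.
Context (K : realType) (R : pzRingType) (X : preTopZmodType).
Context (mu : {measure set (borel X) -> \bar K}) (A : polishModType K R).

Local Notation L := (L0 mu A).

Definition L0_bad (g : L) (U : set A) : set (borel X) := [set x | ~ U (L0_fun g x)].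

Lemma measurable_preimage_open (f : borel X -> borel A) (U : set A) :
  measurable_fun setT f -> open U -> measurable [set x | U (f x)].
Proof.
move=> mf oU; rewrite -[X in measurable X]setTI; apply: mf => //.
exact: borel_open.
Qed.

Lemma measurable_L0_bad g U : open U -> measurable (L0_bad g U).
Proof.
move=> oU; apply: measurableC.
by apply: measurable_preimage_open => //; exact: L0_measurable.
Qed.

(** The two sets can differ, because the class [g - f] has its own chosen representative, but only
    on a null set. This turns the neighbourhoods of [f] into translates of neighbourhoods of 0. *)
Lemma far_setE (f g : L) U : open U -> mu (far_set f g U) = mu (L0_bad (g - f) U).
Proof.
move=> oU; have mf := @measurable_far_set K R X mu A f g U oU.
have mb := measurable_L0_bad (g - f) oU.
by apply/eqP; rewrite eq_le; apply/andP; split; apply: ae_le_measure => //;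
  apply: (ae_imp (L0B g f)) => x gf; rewrite /far_set /L0_bad /= gf.
Qed.

Lemma L0_nbhsP (f : L) V : nbhs f V <-> exists (U : set A) (e : K),
  [/\ open U, U 0, 0 < e & forall g, (mu (L0_bad (g - f)%R U) < e%:E)%E -> V g].
Proof.
split=> -[U [e [oU U0 e0 UV]]]; exists U, e; split => // g.
  by rewrite -far_setE// => /UV.
by rewrite /near_in_measure /= far_setE// => /UV.
Qed.

Lemma L0_bad_add (f g : L) (U W : set A) : open U -> open W ->
  (forall x y, W x -> W y -> U (x + y)) ->
  (mu (L0_bad (f + g)%R U) <= mu (L0_bad f W) + mu (L0_bad g W))%E.
Proof.
move=> oU oW WU.
have mf := measurable_L0_bad f oW; have mg := measurable_L0_bad g oW.
apply: (@le_trans _ _ (mu (L0_bad f W `|` L0_bad g W))); last exact: measureU2.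
apply: ae_le_measure; [exact: measurable_L0_bad|exact: measurableU|].
apply: (ae_imp (L0D f g)) => x; rewrite /L0_bad /= => -> nU.
have [Wf|] := pselect (W (L0_fun f x)); last by left.
by right => Wg; apply: nU; exact: WU.
Qed.

Lemma L0_bad_opp (f : L) (W : set A) : open W -> (forall x, W x -> W (- x)) ->
  (mu (L0_bad (- f)%R W) <= mu (L0_bad f W))%E.
Proof.
move=> oW NW; apply: ae_le_measure; try exact: measurable_L0_bad.
apply: (ae_imp (L0N f)) => x; rewrite /L0_bad /= => -> nW Wf.
by apply: nW; exact: NW.
Qed.

Lemma L0_continuous_sub : continuous_sub L.
Proof.
have cA : continuous_sub A by exact: sub_continuous.
move=> [f g] V /L0_nbhsP[U [e [oU U0 e0 UV]]].
have [W [oW W0 NW WU]] := nbhs0_half cA (open_nbhs_nbhs (conj oU U0)).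
have e20 : 0 < e / 2 by rewrite divr_gt0.
pose N h : set L := [set g | (mu (L0_bad (g - h)%R W) < (e / 2)%:E)%E].
have NN h : nbhs h (N h) by apply/L0_nbhsP; exists W, (e / 2).
exists (N f, N g) => //= -[f' g'] [/= Nf Ng]; apply: UV => /=.
rewrite sub_interchange.
apply: le_lt_trans (L0_bad_add _ _ oU oW WU) _.
rewrite [e]splitr EFinD; apply: lteD => //.
exact: le_lt_trans (L0_bad_opp _ oW NW) Ng.
Qed.

End L0Group.

(** * Completeness of [L0] *)

Section L0Complete.
Context (K : realType) (R : pzRingType) (X : preTopZmodType).
Context (mu : {measure set (borel X) -> \bar K}) (A : polishModType K R).
Context (U : nat -> set A) (hU : halving_base U).

Local Notation L := (L0 mu A).

Let cA : continuous_sub A. Proof. exact: sub_continuous. Qed.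
Let cL : continuous_sub L. Proof. exact: L0_continuous_sub. Qed.

(** The same [k] bounds the values and the measure of the exceptional set. With the exponent [k.+1]
    the measures from [k] on sum to at most [2^-1 ^+ k]. *)
Definition L0_base (k : nat) : set L :=
  [set g | (mu (L0_bad g (U k)) < (2^-1 ^+ k.+1)%:E)%E].

Lemma L0_base_le (g : L) j k : (j <= k)%N ->
  (mu (L0_bad g (U j)) <= mu (L0_bad g (U k)))%E.
Proof.
move=> jk; apply: le_measure; rewrite ?inE.
- by apply: measurable_L0_bad; exact: hb_open hU j.
- by apply: measurable_L0_bad; exact: hb_open hU k.
- by move=> x nU /(hb_le hU jk).
Qed.

Lemma L0_base0 : base0 L0_base.
Proof.
split=> [k|V /L0_nbhsP[W [e [oW W0 e0 WV]]]].
  apply/L0_nbhsP; exists (U k), (2^-1 ^+ k.+1); split.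
  - exact: hb_open hU k.
  - exact: hb_zero hU k.
  - by rewrite exprn_gt0.
  - by move=> g; rewrite subr0.
have [m mW] := hb_base hU (open_nbhs_nbhs (conj oW W0)).
have [n nE] := half_lt e0.
exists (maxn m n) => g gB; apply: WV; rewrite subr0.
apply: (@le_lt_trans _ _ (mu (L0_bad g (U (maxn m n))))).
  apply: le_measure; rewrite ?inE; try exact: measurable_L0_bad.
    by apply: measurable_L0_bad; exact: hb_open hU _.
  by move=> x nW /(hb_le hU (leq_maxl m n))/mW.
apply: lt_le_trans gB _; rewrite lee_fin; apply: le_trans (ltW nE).
rewrite ler_wiXn2l// ?invr_ge0 ?invf_le1// ?ler1n//.
by rewrite leqW// leq_maxr.
Qed.

Lemma L0_sep : (forall x : A, (forall n, U n x) -> x = 0) ->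
  forall g : L, (forall V, nbhs 0 V -> V g) -> g = 0.
Proof.
move=> sepU g h; apply/L0_eqP.
have mb n : measurable (L0_bad g (U n)).
  by apply: measurable_L0_bad; exact: hb_open hU n.
have b0 n : mu (L0_bad g (U n)) = 0%E.
  apply/eqP; rewrite eq_le measure_ge0 andbT; apply/lee_addgt0Pr => e e0.
  have [k ke] := half_lt e0; rewrite add0e.
  apply: le_trans (L0_base_le g (leq_maxl n k)) _.
  apply: le_trans (ltW (h _ (L0_base0.1 (maxn n k)))) _.
  rewrite lee_fin; apply: le_trans (ltW ke).
  rewrite ler_wiXn2l// ?invr_ge0 ?invf_le1// ?ler1n//.
  by rewrite leqW// leq_maxr.
have aeU : {ae mu, forall x, forall n, U n (L0_fun g x)}.
  apply: ae_foralln => n; exists (L0_bad g (U n)); split => //.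
have z := @L0_zeroE K R X mu A.
by apply: (ae_imp (ae_and aeU z)) => x [/sepU -> ->].
Qed.

Section Limit.
Variables (f : nat -> L).
Hypothesis f_step : forall k, (mu (L0_bad (f k.+1 - f k)%R (U k)) < (2^-1 ^+ k.+1)%:E)%E.
Hypothesis A_complete : gcomplete A.

(** Outside [T k] every step from [k] on is small, so the values of [f] form a Cauchy sequence
    there; [N] collects the points that no [k] serves, and the limit is set to 0 on it. *)
Let bad k : set (borel X) := far_set (f k) (f k.+1) (U k).
Let T k := \bigcup_(j >= k) bad j.
Let N := \bigcap_k T k.

Let mbad k : measurable (bad k).
Proof. by apply: measurable_far_set; exact: hb_open hU k. Qed.
Let mT k : measurable (T k). Proof. exact: bigcup_measurable. Qed.
Let mN : measurable N. Proof. exact: bigcapT_measurable. Qed.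

Let bad_le k : (mu (bad k) <= (2^-1 ^+ k.+1)%:E)%E.
Proof. by rewrite /bad far_setE ?ltW//; exact: hb_open hU k. Qed.

Let step k x j : ~ T k x -> (k <= j)%N -> U j (L0_fun (f j.+1) x - L0_fun (f j) x).
Proof.
by move=> nT kj; apply: contrapT => nU; apply: nT; exists j.
Qed.

Let near k x n : ~ T k x -> (k < n)%N -> U k (L0_fun (f n) x - L0_fun (f k.+1) x).
Proof.
move=> nT kn; rewrite -(subnKC kn).
apply: (chain_near hU (u := fun i => L0_fun (f i) x)) => i /andP[ki _].
exact: step nT (ltnW ki).
Qed.

Lemma L0_pointwise_limit : exists F : borel X -> borel A,
  (forall x, N x -> F x = 0) /\
  (forall x, ~ N x -> L0_fun (f n) x @[n --> \oo] --> (F x : A)).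
Proof.
suff /choice[F FP] : forall x, exists l : A, (N x -> l = 0) /\
    (~ N x -> L0_fun (f n) x @[n --> \oo] --> l).
  by exists F; split => x; [exact: (FP x).1|exact: (FP x).2].
move=> x; have [Nx|nN] := pselect (N x); first by exists 0; split.
have [k nT] : exists k, ~ T k x by apply/existsNP => h; apply: nN => k _; exact: h.
have [|l fl] := A_complete (u := fun n => L0_fun (f n) x); last by exists l.
move=> V /(hb_base hU)[j jV]; pose m := maxn k j.+1.
have nTm : ~ T m x.
  by move=> [i /= mi bi]; apply: nT; exists i => //=; rewrite (leq_trans _ mi)// leq_maxl.
exists m.+1 => p q mp mq; apply: jV.
have jm := hb_le hU (leq_maxr k j.+1).
have := hb_sub hU (jm _ (near nTm mp)) (jm _ (near nTm mq)).
by rewrite opprB addrA subrK.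
Qed.

Lemma measurable_pointwise_limit (F : borel X -> borel A) :
  (forall x, N x -> F x = 0) ->
  (forall x, ~ N x -> L0_fun (f n) x @[n --> \oo] --> (F x : A)) ->
  measurable_fun setT F.
Proof.
move=> F0 Flim.
apply: (@measurability _ _ (borel X) (borel A) _ _ (@open A)) => //.
move=> _ [V oV <-]; rewrite setTI.
(* The interior makes [V_ j] open. The limit lies in [V] exactly when the [f n] eventually stay in
   some [V_ j], which is a countable combination of measurable conditions. *)
pose V_ j : set A := [set y | forall u, U j u -> V (y + u)]°.
pose E := \bigcup_j \bigcup_m \bigcap_(n >= m) [set x | V_ j (L0_fun (f n) x)].
have -> : F @^-1` V = (N `&` [set _ | V 0]) `|` (~` N `&` E).
  rewrite eqEsubset; split => x /=.
    have [Nx|nN] := pselect (N x); first by rewrite F0//; left.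
    move=> VF; right; split => //.
    have : nbhs (F x : A) V by exact: open_nbhs_nbhs.
    move=> /(nbhs_shift cA)/(hb_base hU)[i iV].
    have [m mP] := cvg_halvingP cA hU (Flim _ nN) i.+1.
    (* The first halving of [U i] sets aside the error of [f n]; the second leaves room for the move
       inside the interior and for the translate by [u]. *)
    exists i.+2 => //; exists m => // n /= mn; rewrite /V_ /interior.
    apply/(nbhs_shift cA); apply: filterS ((halving_base0 hU).1 i.+2) => u' Uu' u Uu.
    have := iV _ (hb_add hU (mP n mn) (hb_add hU Uu' Uu)).
    by rewrite /= addrA [in F x + _]addrC subrK addrA.
  move=> [[Nx V0]|[nN [j _ [m _ mP]]]]; first by rewrite F0.
  have [p pP] := cvg_halvingP cA hU (Flim _ nN) j.
  have := interior_subset (mP (maxn m p) (leq_maxl _ _)).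
  move=> /(_ _ (hb_opp hU (pP _ (leq_maxr m p)))).
  by rewrite opprB addrC subrK.
apply: measurableU; apply: measurableI => //.
- have [V0|nV0] := pselect (V 0).
    by rewrite (_ : [set _ | _] = setT)//; apply/seteqP; split.
  by rewrite (_ : [set _ | _] = set0)//; apply/seteqP; split.
- exact: measurableC.
- apply: bigcupT_measurable => j; apply: bigcupT_measurable => m.
  apply: bigcap_measurable; first by exists m => /=.
  move=> n _; apply: measurable_preimage_open.
    exact: L0_measurable.
  exact: open_interior.
Qed.

Lemma L0_rapid_cvg : exists l : L, f n @[n --> \oo] --> l.
Proof.
have [F [F0 Flim]] := L0_pointwise_limit.
have mF := measurable_pointwise_limit F0 Flim.
exists (L0_class mu mF); apply: (cvg_nbhs0 cL) => V /L0_base0.2[k kV].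
(* Off [T k.+2], of measure at most [2^-1 ^+ k.+2], the terms from [k.+3] on differ from one another
   by elements of [U k.+1]; comparison with a term already within [U k.+1] of the limit uses the
   other half of [U k]. *)
exists k.+4 => n kn; apply: kV; rewrite /L0_base /=.
apply: (@le_lt_trans _ _ (mu (T k.+2))); last first.
  apply: le_lt_trans (measure_tail_half mbad bad_le k.+2) _.
  by rewrite lte_fin exprSr gtr_pMr ?exprn_gt0// invf_lt1// ltr1n.
have oUk := hb_open hU k.
apply: ae_le_measure => //; first exact: measurable_L0_bad.
have hB := L0B (f n) (L0_class mu mF).
have hF := L0_classE mu mF.
apply: (ae_imp (ae_and hB hF)) => x [hBx hFx].
rewrite /L0_bad /= hBx hFx => nU; apply: contrapT => nT; apply: nU.
have nN : ~ N x by move=> Nx; apply: nT; exact: Nx.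
have [m mP] := cvg_halvingP cA hU (Flim _ nN) k.+1.
have h1 := near nT (n := n) (ltnW kn).
have h2 := near nT (n := maxn m n) (leq_trans (ltnW kn) (leq_maxr _ _)).
have := hb_add hU (hb_sub hU h1 h2) (mP _ (leq_maxl m n)).
by rewrite opprB !subrKA.
Qed.

End Limit.

Lemma L0_gcomplete : gcomplete A -> gcomplete L.
Proof.
move=> compA; have [V hV VB] := halving_base_exists cL L0_base0.
apply: (gcomplete_rapid cL hV) => f rf; apply: (L0_rapid_cvg _ compA) => k.
exact: VB (rf k).
Qed.

End L0Complete.

(** * Separability of [L0] *)

Section L0Separable.
Context (K : realType) (R : pzRingType) (X : preTopZmodType).
Context (mu : {measure set (borel X) -> \bar K}) (A : polishModType K R).
Hypothesis muT : (mu setT < +oo)%E.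

Local Notation L := (L0 mu A).

Let cA : continuous_sub A. Proof. exact: sub_continuous. Qed.
Let cL : continuous_sub L. Proof. exact: L0_continuous_sub. Qed.

Lemma measurable_step (a : A) (E : set (borel X)) : measurable E ->
  measurable_fun setT ((fun x => if x \in E then a else 0) : borel X -> borel A).
Proof.
move=> mE _ Y mY; rewrite setTI.
rewrite (_ : _ @^-1` Y =
    (E `&` [set _ | Y a]) `|` (~` E `&` [set _ | Y 0])); last first.
  rewrite eqEsubset; split => x /=.
    by case: ifPn => [/set_mem|/negP nE] ?; [left|right; split => // /mem_set].
  by move=> [[/mem_set -> //]|[nE Y0]]; rewrite memNset.
have mc (P : Prop) : measurable ([set _ | P] : set (borel X)).
  have [p|np] := pselect P.
    by rewrite (_ : [set _ | _] = setT)//; apply/seteqP; split.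
  by rewrite (_ : [set _ | _] = set0)//; apply/seteqP; split.
by apply: measurableU; apply: measurableI => //; exact: measurableC.
Qed.

Definition L0_step (a : A) (E : set (borel X)) : L :=
  if pselect (measurable E) is left mE then L0_class mu (measurable_step a mE)
  else 0.

Lemma L0_stepE a E : measurable E ->
  {ae mu, forall x, L0_fun (L0_step a E) x = if x \in E then a else 0}.
Proof.
by move=> mE; rewrite /L0_step; case: pselect => // mE'; exact: L0_classE.
Qed.

Context (J : countType) (B : J -> set X).
Hypothesis B_open : forall j, open (B j).
Hypothesis B_setI : forall i j, exists k, B i `&` B j = B k.
Hypothesis B_base : forall x V, nbhs x V -> exists2 j, B j x & B j `<=` V.

(** Each open set is a countable union of sets of the base; codes that name no base set inside [U]
    contribute [set0]. *)
Lemma borel_countable_base (E : set (borel X)) : measurable E ->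
  (<<s range B>> : set (set X)) E.
Proof.
move=> mE; apply: mE; split; first exact: smallest_sigma_algebra.
move=> U oU.
rewrite (_ : U = \bigcup_n (if unpickle n is Some j then
    if `[< B j `<=` U >] then B j else set0 else set0)); last first.
  rewrite eqEsubset; split => x.
    move=> Ux; have [j Bx BU] := B_base (open_nbhs_nbhs (conj oU Ux)).
    by exists (pickle j) => //; rewrite pickleK; case: asboolP.
  by move=> [n _]; case: unpickle => // j; case: asboolP => // BU /BU.
apply: sigma_algebra_bigcup => n; case: unpickle => [j|]; last exact: sigma_algebra0.
case: asboolP => _; last exact: sigma_algebra0.
by apply: sub_sigma_algebra; exists j.
Qed.

Context (I : countType) (e : I -> A).
Hypothesis e_dense : forall x V, nbhs 0 V -> exists i, V (e i - x).

(** Signed steps over base sets, or over the whole space for [None]. The sign is part of the code,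
    so the finite sums [gens] form a countable family closed under differences; [H] is its
    closure. *)
Let gen (t : bool * option J * I) : L :=
  let s := L0_step (e t.2) (if t.1.2 is Some j then B j else setT) in
  if t.1.1 then s else - s.
Let gens (s : seq (bool * option J * I)) : L := \sum_(t <- s) gen t.
Let H (g : L) := forall V, nbhs 0 V -> exists s, V (gens s - g).

Let H_gen t : H (gen t).
Proof.
move=> V V0; exists [:: t]; rewrite /gens big_seq1 subrr; exact: nbhs_singleton.
Qed.

Let H0 : H 0.
Proof.
by move=> V V0; exists [::]; rewrite /gens big_nil subrr; exact: nbhs_singleton.
Qed.

Let HB f g : H f -> H g -> H (f - g).
Proof.
move=> Hf Hg V V0; have [W [oW W0 NW WV]] := nbhs0_half cL V0.
have nW : nbhs 0 W by exact: open_nbhs_nbhs.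
have [s sf] := Hf W nW; have [t tg] := Hg W nW.
exists (s ++ [seq (~~ p.1.1, p.1.2, p.2) | p <- t]).
rewrite /gens big_cat big_map /=.
have -> : \sum_(p <- t) gen (~~ p.1.1, p.1.2, p.2) = - gens t.
  rewrite /gens -sumrN; apply: eq_bigr => p _; rewrite /gen /=.
  by case: (p.1.1); rewrite //= opprK.
by rewrite sub_interchange; exact: WV (NW _ tg).
Qed.

Let H_closed g : (forall V, nbhs 0 V -> exists2 h, H h & V (h - g)) -> H g.
Proof.
move=> h V V0; have [W [oW W0 NW WV]] := nbhs0_half cL V0.
have nW : nbhs 0 W by exact: open_nbhs_nbhs.
have [f Hf fg] := h W nW; have [s sf] := Hf W nW.
by exists s; have := WV _ _ sf fg; rewrite addrA subrK.
Qed.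

Let ae_class0 (g : L) (P : set (borel X)) (W : set A) : open W -> W 0 ->
  measurable P -> {ae mu, forall x, ~ P x -> L0_fun g x = 0} ->
  (mu (L0_bad g W) <= mu P)%E.
Proof.
move=> oW W0 mP gP; apply: ae_le_measure => //; first exact: measurable_L0_bad.
by apply: (ae_imp gP) => x h nW; apply: contrapT => /h g0; apply: nW; rewrite g0.
Qed.

(** Prepares the pi-lambda argument: a proper difference of sets gives a difference of steps, and
    along an increasing union the steps converge because the remaining measure tends to 0. *)
Let step_lambda :
  lambda_system setT [set E : set (borel X) | measurable E /\ forall i, H (L0_step (e i) E)].
Proof.
split.
- by [].
- by split => // i; exact: (H_gen (true, None, i)).
- move=> E F FE [mE HE] [mF HF]; have mD : measurable (E `\` F) by exact: measurableD.
  split => // i.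
  rewrite (_ : L0_step _ _ = L0_step (e i) E - L0_step (e i) F); first exact: HB.
  apply/L0_eqP; have a1 := L0B (L0_step (e i) E) (L0_step (e i) F).
  have a2 := ae_and (L0_stepE (e i) mE) (ae_and (L0_stepE (e i) mF) (L0_stepE (e i) mD)).
  apply: (ae_imp (ae_and a1 a2)) => x [-> [-> [-> ->]]].
  rewrite in_setD; have [/set_mem Fx|nF] := boolP (x \in F).
    by rewrite (mem_set (FE _ Fx)) subrr.
  by case: (x \in E); rewrite /= subr0.
- move=> F ndF mHF; have mF k : measurable (F k) by have [] := mHF k.
  have mU : measurable (\bigcup_k F k) by exact: bigcup_measurable.
  split => // i; apply: H_closed => V /L0_nbhsP[W [d [oW W0 d0 WV]]].
  have [k kd] := measure_exhaust muT mF ndF (erefl _) d0.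
  exists (L0_step (e i) (F k)); first by have [] := mHF k.
  apply: WV; rewrite subr0; apply: le_lt_trans kd; apply: ae_class0 => //.
    exact: measurableD.
  have a1 := L0B (L0_step (e i) (F k)) (L0_step (e i) (\bigcup_k F k)).
  apply: (ae_imp (ae_and a1 (ae_and (L0_stepE (e i) (mF k)) (L0_stepE (e i) mU)))).
  move=> x [-> [-> ->]] nx; have [Fx|nF] := boolP (x \in F k).
    by rewrite mem_set ?subrr//; exists k => //; exact: set_mem.
  rewrite memNset ?subrr// => Ux; apply: nx; split => //.
  by move=> Fx; move/negP: nF; apply; exact: mem_set.
Qed.

Let H_step E : measurable E -> forall i, H (L0_step (e i) E).
Proof.
move=> mE; suff [] : [set E : set (borel X) | measurable E /\ forall i, H (L0_step (e i) E)] E by [].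
apply: (lambda_system_subset (G := range B) _ step_lambda _ _ (borel_countable_base mE)).
- by move=> _ _ [i _ <-] [j _ <-]; have [k ->] := B_setI i j; exists k.
- move=> _ [j _ <-]; split; first exact: borel_open.
  by move=> i; exact: (H_gen (true, Some j, i)).
- by [].
Qed.

Let H_all g : H g.
Proof.
apply: H_closed => V /L0_nbhsP[U [d [oU U0 d0 UV]]].
have [W [oW W0 NW _]] := nbhs0_half cA (open_nbhs_nbhs (conj oU U0)).
have [i0 _] := e_dense 0 filterT.
pose a n := if unpickle n is Some i then i else i0.
pose E n : set (borel X) := [set x | U (e (a n) - L0_fun g x)].
have mE n : measurable (E n).
  have ms : measurable_fun setT (cst (e (a n)) : borel X -> borel A) by exact: measurable_cst.
  have mfB := measurable_funB_borel ms (L0_measurable g).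
  exact: (measurable_preimage_open mfB oU).
have coverE : \bigcup_n E n = setT.
  apply/seteqP; split => // x _.
  have [i Ui] := e_dense (L0_fun g x) (open_nbhs_nbhs (conj oU U0)).
  by exists (pickle i) => //; rewrite /E /a pickleK.
pose F n := \big[setU/set0]_(i < n) E i.
have mF n : measurable (F n) by exact: bigsetU_measurable.
(* By finiteness of [mu], finitely many of the sets on which a constant is [U]-close to [g] cover
   all but measure [d]. *)
have [n nd] : exists n, (mu (~` F n) < d%:E)%E.
  have [||n] := measure_exhaust muT mF _ _ d0 (E := setT).
  - by move=> m n mn; apply/subsetPset; exact: subset_bigsetU.
  - apply/esym/seteqP; split => // x _.
    have : (\bigcup_n E n) x by rewrite coverE.
    by move=> [n _ En]; exists n.+1 => //; apply: bigsetU_sup En.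
  by rewrite setTD; exists n.
(* Making the sets disjoint keeps the values of the steps from adding up: at each point of [F k]
   exactly one approximant is taken. *)
have mD k : measurable (seqDU E k) by exact: seqDU_measurable.
pose h k : L := \sum_(i < k) L0_step (e (a i)) (seqDU E i).
have hE k : {ae mu, forall x, (F k x -> U (L0_fun (h k) x - L0_fun g x)) /\
    (~ F k x -> L0_fun (h k) x = 0)}.
  elim: k => [|k IH].
    apply: (ae_imp (@L0_zeroE K R X mu A)) => x h0.
    by rewrite /h /F !big_ord0; split.
  have a1 := L0D (h k) (L0_step (e (a k)) (seqDU E k)).
  apply: (ae_imp (ae_and IH (ae_and a1 (L0_stepE (e (a k)) (mD k))))) => x.
  move=> [[IH1 IH2] [hk sk]].
  rewrite /h /F !big_ord_recr /= -/(h k) -/(F k) hk sk /seqDU.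
  have [Fx|nFx] := pselect (F k x).
    rewrite memNset ?addr0; last by move=> [].
    by split => [_|nF]; [exact: IH1|case: nF; left].
  rewrite (IH2 nFx) add0r; split => [[//|Ex]|nFE].
    by rewrite mem_set//; split.
  by rewrite memNset// => -[Ex _]; apply: nFE; right.
exists (h n).
  rewrite /h; elim/big_ind: _ => [|f1 f2 Hf1 Hf2|k _]; [exact: H0| |exact: H_step].
  rewrite (_ : f1 + f2 = f1 - (0 - f2)); last by rewrite sub0r opprK.
  exact: HB Hf1 (HB H0 Hf2).
apply: UV; rewrite subr0; apply: le_lt_trans nd.
apply: ae_le_measure; [exact: measurable_L0_bad|exact: measurableC|].
apply: (ae_imp (ae_and (L0B (h n) g) (hE n))) => x [hg [h1 _]] nU Fx.
by apply: nU; rewrite hg; exact: h1.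
Qed.

Lemma L0_separable : exists (S : countType) (s : S -> L),
  forall g V, nbhs 0 V -> exists i, V (s i - g).
Proof. by exists (seq (bool * option J * I))%type, gens; exact: H_all. Qed.

End L0Separable.

Section ModuleAction.
Variables (K : realType) (R : pzRingType) (M : polishModType K R).

Lemma actDr (r : R) (x y : M) : r *! (x + y) = r *! x + r *! y.
Proof. exact: (scalerDr r (x : lmod_of M) y). Qed.

Lemma actB (r : R) (x y : M) : r *! (x - y) = r *! x - r *! y.
Proof. exact: (scalerBr r (x : lmod_of M) y). Qed.

Lemma act0r (r : R) : r *! (0 : M) = 0.
Proof. exact: (scaler0 (lmod_of M) r). Qed.

Lemma actDl (r s : R) (x : M) : (r + s) *! x = r *! x + s *! x.
Proof. exact: (scalerDl (x : lmod_of M) r s). Qed.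

Lemma actA (r s : R) (x : M) : r *! (s *! x) = (r * s) *! x.
Proof. exact: (scalerA r s (x : lmod_of M)). Qed.

Lemma act1l (x : M) : 1 *! x = x.
Proof. exact: (scale1r (x : lmod_of M)). Qed.

Lemma act0l (x : M) : 0 *! x = 0.
Proof. exact: (scale0r (x : lmod_of M)). Qed.

Lemma act_sum (r : R) (I : Type) (s : seq I) (P : pred I) (F : I -> M) :
  r *! (\sum_(i <- s | P i) F i) = \sum_(i <- s | P i) r *! F i.
Proof. exact: (@scaler_sumr R (lmod_of M)). Qed.

End ModuleAction.

Lemma polish_module_complete_group (K : realType) (R : pzRingType)
  (M : polishModType K R) : complete_group M.
Proof.
apply: (@polish_complete_group K); split; first exact: sub_continuous.
exact: polish_carrier.
Qed.

(** * Countable bases stable under intersection *)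

Definition pi_base (X : topologicalType) (J : Type) (B : J -> set X) : Prop :=
  [/\ forall j, open (B j), forall i j, exists k, B i `&` B j = B k &
      forall x V, nbhs x V -> exists2 j, B j x & B j `<=` V].

Lemma complete_group_pi_base (G : preTopZmodType) : complete_group G ->
  exists (J : countType) (B : J -> set G), pi_base B.
Proof.
move=> cpG; have cG := cg_sub cpG; have [U hU] := cg_halving cpG.
have [I [e eI]] := cg_separable cpG.
pose b (p : I * nat) : set G := [set y | U p.2 (y - e p.1)].
have ob p : open (b p).
  rewrite openE => y; rewrite /b /= => Uy; rewrite /interior; apply/(nbhs_shift cG).
  have : nbhs (y - e p.1) (U p.2).
    by apply: open_nbhs_nbhs; split => //; exact: hb_open hU _.
  by move=> /(nbhs_shift cG); apply: filterS => u /=; rewrite addrAC.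
(* Lists code finite intersections, the empty list being the whole space; concatenation gives
   stability under intersection. *)
exists (seq (I * nat)), (fun s => [set y | forall p, p \in s -> b p y]); split.
- elim=> [|p s IH].
    by rewrite (_ : [set _ | _] = setT); [exact: openT|apply/seteqP; split].
  rewrite (_ : [set _ | _] = b p `&` [set y | forall q, q \in s -> b q y]).
    exact: openI.
  apply/seteqP; split => y /=.
    by move=> h; split => [|q qs]; apply: h; rewrite inE ?eqxx// qs orbT.
  by move=> [py h] q; rewrite inE => /orP[/eqP ->|/h].
- move=> s t; exists (s ++ t); apply/seteqP; split => y /=.
    by move=> [hs ht] p; rewrite mem_cat => /orP[/hs|/ht].
  by move=> h; split => p ps; apply: h; rewrite mem_cat ps ?orbT.
- move=> x V /(nbhs_shift cG)/(hb_base hU)[k kV].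
  have [i ix] := eI x _ ((halving_base0 hU).1 k.+1).
  exists [:: (i, k.+1)] => /=.
    by move=> p; rewrite inE => /eqP ->; rewrite /b /= -opprB; exact: hb_opp.
  move=> y /(_ (i, k.+1)); rewrite inE eqxx => /(_ isT) yi.
  have := kV _ (hb_add hU yi ix).
  by rewrite /= subrKA addrC subrK.
Qed.

Lemma pi_base_row (X : preTopZmodType) (J : countType) (B : J -> set X) (n : nat) :
  pi_base B -> exists (J' : countType) (B' : J' -> set 'rV[X]_n), pi_base B'.
Proof.
move=> [oB BI Bb].
exists {ffun 'I_n -> J}, (fun t : {ffun 'I_n -> J} => [set v : 'rV[X]_n | forall j, B (t j) (v ord0 j)]); split.
- move=> t; rewrite openE => v tv; exists (fun _ j => B (t j)) => [i j|w tw j].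
    by rewrite ord1; apply: open_nbhs_nbhs; split.
  exact: tw.
- move=> s t; have /choice[k kP] : forall j, exists k, B (s j) `&` B (t j) = B k.
    by move=> j; exact: BI.
  exists [ffun j => k j]; apply/seteqP; split => v /=.
    by move=> [sv tv] j; rewrite ffunE -kP.
  move=> kv; split=> j; have := kv j; rewrite ffunE -kP; by case.
- move=> v V [P vP PV].
  have /choice[t tP] : forall j, exists t, B t (v ord0 j) /\ B t `<=` P ord0 j.
    by move=> j; have [t tv tP] := Bb _ _ (vP ord0 j); exists t.
  exists [ffun j => t j] => [j|w tw]; first by rewrite ffunE; exact: (tP j).1.
  apply: PV => i j; rewrite ord1; apply: (tP j).2.
  by have := tw j; rewrite ffunE.
Qed.

Section CompleteL0.
Context (K : realType) (R : pzRingType) (X : preTopZmodType).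
Context (mu : {measure set (borel X) -> \bar K}) (A : polishModType K R).

Lemma complete_group_L0 (J : countType) (B : J -> set X) :
  (mu setT < +oo)%E -> pi_base B -> complete_group (L0 mu A).
Proof.
move=> muT [oB BI Bb]; have cpA := polish_module_complete_group A.
have [U hU] := cg_halving cpA; have [I [e eI]] := cg_separable cpA.
split.
- exact: L0_continuous_sub.
- by exists (@L0_base K R X mu A U); exact: L0_base0.
- apply: (L0_sep hU) => x h; apply: (cg_sep cpA) => V /(hb_base hU)[n]; exact.
- exact: (L0_separable muT oB BI Bb eI).
- exact: (L0_gcomplete hU (cg_complete cpA)).
Qed.

End CompleteL0.

(** * Pullback of classes along a continuous map *)

Section Pullback.
Context (K : realType) (R : pzRingType) (X Y : preTopZmodType).
Context (muX : {measure set (borel X) -> \bar K}).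
Context (muY : {measure set (borel Y) -> \bar K}) (A : polishModType K R).
Hypothesis muXT : (muX setT < +oo)%E.
Context (T : X -> Y) (cT : continuous T).
Hypothesis T_null : forall N : set (borel Y), measurable N -> muY N = 0 ->
  muX (T @^-1` N) = 0.

Let mT : measurable_fun setT (T : borel X -> borel Y).
Proof. exact: continuous_borel. Qed.

Let mpre (N : set (borel Y)) : measurable N -> measurable (T @^-1` N : set (borel X)).
Proof. by move=> mN; rewrite -[X in measurable X]setTI; exact: mT. Qed.

Lemma ae_pullback (P : Y -> Prop) : {ae muY, forall y : borel Y, P y} ->
  {ae muX, forall x : borel X, P (T x)}.
Proof.
move=> [N [mN N0 PN]]; exists (T @^-1` N); split.
- exact: mpre.
- exact: T_null.
- by move=> x nP; apply: PN.
Qed.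

(** Absolute continuity in epsilon-delta form. Otherwise there are sets with summable measures whose
    preimages have mass at least [e]; their limsup is null by Borel-Cantelli, while in a finite
    measure space the limsup of the preimages keeps mass at least [e]. *)
Lemma pullback_uniform (e : K) : 0 < e -> exists k : nat,
  forall E : set (borel Y), measurable E ->
    (muY E < (2^-1 ^+ k.+1)%:E)%E -> (muX (T @^-1` E) < e%:E)%E.
Proof.
move=> e0; apply: contrapT => h.
have {}h k : exists E : set (borel Y), [/\ measurable E,
    (muY E < (2^-1 ^+ k.+1)%:E)%E & (e%:E <= muX (T @^-1` E))%E].
  apply: contrapT => nE; apply: h; exists k => // E mE Ek.
  by rewrite ltNge; apply/negP => eE; apply: nE; exists E.
have /choice[E EP] := h.
have mE k : measurable (E k) by have [] := EP k.
have E0 : muY (\bigcap_k \bigcup_(j >= k) E j) = 0.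
  by apply: null_tail => // k; have [_ /ltW] := EP k.
pose F k : set (borel X) := T @^-1` E k.
have mF k : measurable (F k) by exact: mpre.
have F0 : muX (lim_sup_set F) = 0.
  rewrite -(T_null _ E0).
    by congr (muX _); apply/seteqP; split => x h k _;
      have [j kj Ej] := h k I; exists j.
  by apply: bigcapT_measurable => k; exact: bigcup_measurable.
have Ffin : (muX (\bigcup_(k >= 0) F k) < +oo)%E.
  apply: le_lt_trans muXT; apply: le_measure; rewrite ?inE//.
  exact: bigcup_measurable.
have := lim_sup_set_cvg muX F mF Ffin; rewrite F0.
move=> /(_ [set y | y < e%:E]%E)[|k _ kP].
  by apply: open_nbhs_nbhs; split; [exact: open_ereal_lt_ereal|rewrite /= lte_fin].
have := kP k (leqnn k); rewrite /= ltNge => /negP; apply.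
have [_ _ eE] := EP k; apply: le_trans eE _; apply: le_measure; rewrite ?inE.
- exact: mF.
- exact: bigcup_measurable.
by move=> x Fx; exists k => /=.
Qed.

Lemma pullback_measurable (f : L0 muY A) :
  measurable_fun setT ((fun x => L0_fun f (T x)) : borel X -> borel A).
Proof. exact: measurableT_comp (L0_measurable f) mT. Qed.

Definition pullback (f : L0 muY A) : L0 muX A := L0_class muX (pullback_measurable f).

Lemma pullbackE f : {ae muX, forall x, L0_fun (pullback f) x = L0_fun f (T x)}.
Proof. exact: L0_classE. Qed.

Lemma pullbackB : {morph pullback : f g / f - g}.
Proof.
move=> f g; apply/L0_eqP.
have a1 := ae_and (pullbackE (f - g)) (L0B (pullback f) (pullback g)).
have a2 := ae_and (pullbackE f) (pullbackE g).
by apply: (ae_imp (ae_and (ae_and a1 a2) (ae_pullback (L0B f g)))) => x [[[-> ->] [-> ->]] ->].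
Qed.

Lemma pullback_continuous : continuous pullback.
Proof.
apply: morphism_continuous; [exact: L0_continuous_sub|exact: L0_continuous_sub|exact: pullbackB|].
move=> V /L0_nbhsP[U [e [oU U0 e0 UV]]].
have [k kP] := pullback_uniform e0.
apply/L0_nbhsP; exists U, (2^-1 ^+ k.+1); split => // g; rewrite subr0 => gU /=; apply: UV; rewrite subr0.
apply: le_lt_trans (kP _ (measurable_L0_bad g oU) gU).
apply: ae_le_measure; [exact: measurable_L0_bad|by apply: mpre; exact: measurable_L0_bad|].
by apply: (ae_imp (pullbackE g)) => x; rewrite /L0_bad /= => ->.
Qed.

End Pullback.

Section ActL0.
Context (K : realType) (R : pzRingType) (X : preTopZmodType).
Context (mu : {measure set (borel X) -> \bar K}) (A : polishModType K R) (r : R).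

Lemma act_L0_measurable (f : L0 mu A) :
  measurable_fun setT ((fun x => r *! L0_fun f x) : borel X -> borel A).
Proof. exact: measurableT_comp (act_measurable r) (L0_measurable f). Qed.

Definition act_L0 (f : L0 mu A) : L0 mu A := L0_class mu (act_L0_measurable f).

Lemma act_L0E f : {ae mu, forall x, L0_fun (act_L0 f) x = r *! L0_fun f x}.
Proof. exact: L0_classE. Qed.

Lemma act_L0B : {morph act_L0 : f g / f - g}.
Proof.
move=> f g; apply/L0_eqP.
have a1 := ae_and (act_L0E (f - g)) (L0B (act_L0 f) (act_L0 g)).
have a2 := ae_and (act_L0E f) (act_L0E g).
apply: (ae_imp (ae_and (ae_and a1 a2) (L0B f g))) => x [[[-> ->] [-> ->]] ->].
exact: actB.
Qed.

Lemma act_L0_continuous : continuous act_L0.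
Proof.
apply: morphism_continuous; [exact: L0_continuous_sub|exact: L0_continuous_sub|exact: act_L0B|].
move=> V /L0_nbhsP[U [e [oU U0 e0 UV]]].
pose W : set A := [set a | U (r *! a)].
have oW : open W by have /continuousP := @act_continuous K R A r; exact.
apply/L0_nbhsP; exists W, e; split => // [|g]; first by rewrite /W /= act0r.
rewrite subr0 => gW /=; apply: UV; rewrite subr0.
apply: le_lt_trans gW; apply: ae_le_measure; try exact: measurable_L0_bad.
by apply: (ae_imp (act_L0E g)) => x; rewrite /L0_bad /= => ->.
Qed.

End ActL0.

(** * Control measures and linear maps *)

Section Control.
Variables (K : realType) (R : pzRingType) (C : polishModType K R).
Variable mu : forall n, probability (borel 'rV[C]_n) K.
Hypothesis mu_control : control_measures mu.

Lemma comb_maps_comp (m n k : nat) (S : 'rV[C]_n -> 'rV[C]_k) (T : 'rV[C]_m -> 'rV[C]_n) :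
  comb_maps S -> comb_maps T -> comb_maps (S \o T).
Proof.
move=> hS hT i; have [s sP] := hS i; have [t tP] := choice hT.
exists (fun j => \sum_(l < n) s l * t l j) => x; rewrite /= sP.
transitivity (\sum_(l < n) \sum_(j < m) (s l * t l j) *! x 0 j).
  by apply: eq_bigr => l _; rewrite (tP l x) act_sum; apply: eq_bigr => j _; rewrite actA.
rewrite exchange_big; apply: eq_bigr => j _.
by rewrite [RHS](@scaler_suml R (lmod_of C)).
Qed.

(** The term of [mu n] at [T] measures the preimage of [B] under [S \o T], which is an index for
    [mu k]. Its weight there is positive, so nullity of [B] forces this term to vanish. *)
Lemma comb_maps_null (n k : nat) (S : 'rV[C]_n -> 'rV[C]_k) (B : set (borel 'rV[C]_k)) :
  (0 < n)%N -> (0 < k)%N -> comb_maps S -> continuous S -> measurable B ->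
  mu k B = 0 -> mu n (S @^-1` B) = 0.
Proof.
move=> n0 k0 hS cS mB; have [lam _ muE] := mu_control.
have [w [w0 _ wE]] := muE n n0; have [v [v0 _ vE]] := muE k k0.
have mSB : measurable (S @^-1` B : set (borel 'rV[C]_n)).
  by rewrite -[X in measurable X]setTI; exact: continuous_borel.
rewrite wE// vE// => B0; apply: esum1 => -[m T] [/= m0 hT].
have hST : comb_indices (existT _ m (S \o T) : comb_index C k).
  by split => //; exact: comb_maps_comp.
have vl : ((v (existT _ m (S \o T)))%:E * lam m ((S \o T) @^-1` B) <= 0)%E.
  rewrite -B0; apply: esum_ge; exists [set (existT _ m (S \o T) : comb_index C k)].
    by split; [exact: finite_set1|move=> _ ->].
  by rewrite fsbig_set1.
have : lam m ((S \o T) @^-1` B) = 0%E.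
  apply/eqP; rewrite eq_le measure_ge0 andbT leNgt; apply/negP => l0.
  by move: vl; rewrite leNgt mule_gt0// lte_fin; exact: v0.
by rewrite /= => ->; rewrite mule0.
Qed.

End Control.

Definition continuous_morphism (G H : preTopZmodType) (f : G -> H) : Prop :=
  {morph f : x y / x - y} /\ continuous f.

Definition closed_subgroup (G : preTopZmodType) (S : set G) : Prop :=
  is_subgroup S /\ closed S.

Lemma closed_subgroup_forall (G : preTopZmodType) (I : Type) (S : I -> set G) :
  (forall i, closed_subgroup (S i)) -> closed_subgroup [set x | forall i, S i x].
Proof.
move=> hS; split.
  split=> [i|x y Sx Sy i]; first exact: (hS i).1.1.
  by apply: (hS i).1.2.
rewrite (_ : [set _ | _] = \bigcap_i S i); last first.
  by apply/seteqP; split => x h i; [move=> _; exact: h|exact: h].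
by apply: closed_bigI => i _; exact: (hS i).2.
Qed.

Lemma closed_subgroupI (G : preTopZmodType) (S T : set G) :
  closed_subgroup S -> closed_subgroup T -> closed_subgroup (S `&` T).
Proof.
move=> hS hT; have := @closed_subgroup_forall G bool (fun b => if b then S else T).
rewrite (_ : [set _ | _] = S `&` T); first by apply; case.
apply/seteqP; split => x /=.
  by move=> h; split; [exact: (h true)|exact: (h false)].
by move=> [Sx Tx]; case.
Qed.

(** [cg_sep] makes the point 0 closed, and the kernel is its preimage. *)
Lemma closed_subgroup_kernel (G H : preTopZmodType) (f : G -> H) :
  complete_group H -> continuous_morphism f -> closed_subgroup [set x | f x = 0].
Proof.
move=> cpH [fB cf]; split.
  by split=> [|x y /= fx fy]; [exact: sub_morph0|rewrite /= fB fx fy subr0].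
have cH := cg_sub cpH; apply: (@preimage_closed _ _ f [set (0 : H)]) => [x _|]; first exact: cf.
move=> y hy; apply: (cg_sep cpH) => V V0.
have : nbhs y [set z | V (y - z)].
  have [W [oW W0 NW WV]] := nbhs0_half cH V0.
  apply/(nbhs_shift cH); apply: filterS (open_nbhs_nbhs (conj oW W0)) => u Wu /=.
  by rewrite opprD addrA subrr -[_ - u]addr0; apply: WV => //; rewrite sub0r; exact: NW.
by move=> /hy[_ [/= ->]]; rewrite /= subr0.
Qed.

Section Cocycles.
Variables (K : realType) (R : pzRingType) (C A : polishModType K R).
Variable mu : forall n, probability (borel 'rV[C]_n) K.
Hypothesis mu_control : control_measures mu.

Local Notation L n := (L0 (mu n) A).

Let muT n : (mu n setT < +oo)%E.
Proof. by rewrite probability_setT ltry. Qed.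

Lemma cochain_complete_group n : complete_group (L n).
Proof.
have [J [B hB]] := complete_group_pi_base (polish_module_complete_group C).
have [J' [B' hB']] := pi_base_row n hB.
exact: complete_group_L0 (muT n) hB'.
Qed.

Definition linear_form m (phi : 'rV[C]_m -> C) : Prop :=
  exists r : 'I_m -> R, forall v, phi v = \sum_(j < m) r j *! v 0 j.

Lemma linear_form_coord m (j : 'I_m) : linear_form (fun v : 'rV[C]_m => v 0 j).
Proof.
exists (fun i => if i == j then 1 else 0) => v; rewrite (bigD1 j) //= eqxx big1.
  by rewrite addr0 act1l.
by move=> i /negbTE ->; rewrite act0l.
Qed.

Lemma linear_form_zero m : linear_form (fun _ : 'rV[C]_m => 0).
Proof.
by exists (fun=> 0) => v; rewrite big1// => i _; rewrite act0l.
Qed.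

Lemma linear_form_add m (phi psi : 'rV[C]_m -> C) :
  linear_form phi -> linear_form psi -> linear_form (fun v => phi v + psi v).
Proof.
move=> [r rE] [s sE]; exists (fun j => r j + s j) => v; rewrite rE sE -big_split /=.
by apply: eq_bigr => j _; rewrite actDl.
Qed.

Lemma linear_form_act m (r : R) (phi : 'rV[C]_m -> C) :
  linear_form phi -> linear_form (fun v => r *! phi v).
Proof.
move=> [s sE]; exists (fun j => r * s j) => v; rewrite sE.
by rewrite act_sum; apply: eq_bigr => j _; rewrite actA.
Qed.

Lemma linear_form_continuous m (phi : 'rV[C]_m -> C) :
  linear_form phi -> continuous phi.
Proof.
move=> [r rE]; rewrite (funext rE).
have cC : continuous_sub C by exact: sub_continuous.
elim: (index_enum _) => [|j s IH].
  rewrite (_ : (fun _ => _) = cst 0); first exact: cst_continuous.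
  by apply/funext => v; rewrite big_nil.
rewrite (_ : (fun _ => _) =
    (fun v : 'rV[C]_m => r j *! v 0 j + \sum_(i <- s) r i *! v 0 i)); last first.
  by apply/funext => v; rewrite big_cons.
move=> v; apply: (@cvg_add C cC _ (nbhs v) (nbhs_filter v)
  (fun v : 'rV[C]_m => r j *! v 0 j)); last exact: IH.
move=> V /(@act_continuous K R C (r j)) Vv.
exact: (@rV_coord_continuous K R C m j v _ Vv).
Qed.

Section Pull.
Variables (m n : nat) (m0 : (0 < m)%N) (n0 : (0 < n)%N).
Variable (phi : 'I_n -> 'rV[C]_m -> C).
Hypothesis phi_lin : forall i, linear_form (phi i).

Let T (v : 'rV[C]_m) : 'rV[C]_n := \row_i phi i v.

Let T_comb : comb_maps T.
Proof. by move=> i; have [r rE] := phi_lin i; exists r => v; rewrite mxE. Qed.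

Let T_continuous : continuous T.
Proof.
move=> v V [P vP PV].
have h i : nbhs v [set w | P 0 i (phi i w)].
  by apply: linear_form_continuous => //; have := vP 0 i; rewrite mxE.
apply: (@filterS _ (nbhs v) (nbhs_filter v) _ _ _
  (@filter_forall _ _ _ (nbhs v) (nbhs_filter v) h)) => w hw.
by apply: PV => j i; rewrite ord1 mxE; exact: hw.
Qed.

Let T_null N : measurable N -> mu n N = 0 -> mu m (T @^-1` N) = 0.
Proof. exact: comb_maps_null. Qed.

Lemma pull_ae (P : 'rV[C]_n -> Prop) :
  {ae mu n, forall w : borel 'rV[C]_n, P w} ->
  {ae mu m, forall v : borel 'rV[C]_m, P (\row_i phi i v)}.
Proof. exact: ae_pullback. Qed.

Lemma pull_exists : exists2 F : L n -> L m, continuous_morphism F &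
  forall f, {ae mu m, forall v : borel 'rV[C]_m, L0_fun (F f) v = L0_fun f (\row_i phi i v)}.
Proof.
exists (pullback (mu m) T_continuous).
  split; first exact: pullbackB.
  by apply: pullback_continuous => //; exact: muT.
exact: pullbackE.
Qed.

End Pull.

End Cocycles.

(** * Cocycles and coboundaries *)

Section Representable.
Variables (K : realType) (R : pzRingType) (C A : polishModType K R).
Variable mu : forall n, probability (borel 'rV[C]_n) K.
Hypothesis mu_control : control_measures mu.

Local Notation L n := (L0 (mu n) A).

(* Expressions in the values of cochains whose almost-everywhere class depends
   continuously and additively on the parameter [z]. *)
Definition representable (G : preTopZmodType) m (F : G -> 'rV[C]_m -> A) : Prop :=
  exists2 Phi : G -> L m, continuous_morphism Phi &
    forall z, {ae mu m, forall v : borel 'rV[C]_m, L0_fun (Phi z) v = F z v}.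

Section Closure.
Variables (G : preTopZmodType) (m : nat) (m0 : (0 < m)%N).
Implicit Types F : G -> 'rV[C]_m -> A.

Let cL : continuous_sub (L m). Proof. exact: L0_continuous_sub. Qed.

Lemma representable_zero : representable (fun (_ : G) (_ : 'rV[C]_m) => 0 : A).
Proof.
exists (fun=> 0) => [|z]; last exact: L0_zeroE.
by split => [x y|]; [rewrite subr0|exact: cst_continuous].
Qed.

Lemma representable_sub F1 F2 : representable F1 -> representable F2 ->
  representable (fun z v => F1 z v - F2 z v).
Proof.
move=> [P [PB cP] PF] [Q [QB cQ] QF]; exists (fun z => P z - Q z).
  split=> [x y|z]; first by rewrite PB QB sub_interchange.
  exact: (cvg_sub cL _ (cP z) (cQ z)).
by move=> z; apply: (ae_imp (ae_and (L0B (P z) (Q z)) (ae_and (PF z) (QF z)))) => v [-> [-> ->]].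
Qed.

Lemma representable_add F1 F2 : representable F1 -> representable F2 ->
  representable (fun z v => F1 z v + F2 z v).
Proof.
move=> r1 r2; have := representable_sub r1 (representable_sub representable_zero r2).
move=> [P cP PF]; exists P => // z.
by apply: (ae_imp (PF z)) => v ->; rewrite sub0r opprK.
Qed.

Lemma representable_act r F : representable F -> representable (fun z v => r *! F z v).
Proof.
move=> [P [PB cP] PF]; exists (fun z => act_L0 r (P z)).
  split=> [x y|z]; first by rewrite PB act_L0B.
  exact: (cvg_comp _ _ (cP z) (@act_L0_continuous _ _ _ _ _ r (P z))).
by move=> z; apply: (ae_imp (ae_and (act_L0E r (P z)) (PF z))) => v [-> ->].
Qed.

Lemma representable_app1 (g : G -> L 1) (phi : 'rV[C]_m -> C) :
  continuous_morphism g -> linear_form phi ->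
  representable (fun z v => app1 (g z) (phi v)).
Proof.
move=> [gB cg] hphi.
have [P [PB cP] PF] := pull_exists A mu_control m0 (isT : (0 < 1)%N) (phi := fun=> phi) (fun=> hphi).
exists (P \o g).
  split=> [x y|z]; first by rewrite /= gB PB.
  exact: (cvg_comp _ _ (cg z) (cP (g z))).
move=> z; apply: (ae_imp (PF (g z))) => v ->; rewrite /app1; congr L0_fun.
by apply/rowP => i; rewrite !mxE ord1.
Qed.

Lemma representable_app2 (g : G -> L 2) (phi psi : 'rV[C]_m -> C) :
  continuous_morphism g -> linear_form phi -> linear_form psi ->
  representable (fun z v => app2 (g z) (phi v) (psi v)).
Proof.
move=> [gB cg] hphi hpsi.
(* The two forms become a family over ['I_2]; the dependent [if] selects the matching proof of
   linearity. *)
have [P [PB cP] PF] := pull_exists A mu_control m0 (isT : (0 < 2)%N)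
  (phi := fun i => if i == ord0 then phi else psi)
  (fun i => if i == ord0 as b return linear_form (if b then phi else psi) then hphi else hpsi).
exists (P \o g).
  split=> [x y|z]; first by rewrite /= gB PB.
  exact: (cvg_comp _ _ (cg z) (cP (g z))).
move=> z; apply: (ae_imp (PF (g z))) => v ->; rewrite /app2; congr L0_fun.
by apply/rowP => -[[|[|//]] i]; rewrite !mxE.
Qed.

(** The two sides agree almost everywhere exactly when the morphism representing their difference
    vanishes, so the set is a kernel. *)
Lemma representable_eq F1 F2 : representable F1 -> representable F2 ->
  closed_subgroup [set z | {ae mu m, forall v : borel 'rV[C]_m, F1 z v = F2 z v}].
Proof.
move=> r1 r2; have [P cP PF] := representable_sub r1 r2.
rewrite (_ : [set _ | _] = [set z | P z = 0]).
  by apply: closed_subgroup_kernel cP; exact: cochain_complete_group.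
have z0 := @L0_zeroE K R _ (mu m) A.
apply/seteqP; split => z /= h.
  by apply/L0_eqP; apply: (ae_imp (ae_and h (ae_and (PF z) z0))) => v [e [-> ->]]; rewrite e subrr.
move/L0_eqP : h => h.
apply: (ae_imp (ae_and h (ae_and (PF z) z0))) => v [-> [+ zv]] => /eqP.
by rewrite zv eq_sym subr_eq0 => /eqP.
Qed.

(** An almost everywhere formula determines the class, so [Q] coincides with the representing
    morphism. Continuity of [delta] and [partial] is read off their formulas in this way. *)
Lemma representable_class (Q : G -> L m) F : representable F ->
  (forall z, {ae mu m, forall v : borel 'rV[C]_m, L0_fun (Q z) v = F z v}) ->
  continuous_morphism Q.
Proof.
move=> [P cP PF] QF; rewrite (_ : Q = P)//; apply/funext => z; apply/L0_eqP.
by apply: (ae_imp (ae_and (PF z) (QF z))) => v [-> ->].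
Qed.

End Closure.

Let coord m (j : 'I_m) := @linear_form_coord K R C m j.
Let ladd := @linear_form_add K R C.
Let lact := @linear_form_act K R C.

Lemma closed_subgroup_cocycles : closed_subgroup (cocycles A mu).
Proof.
pose G : preTopZmodType := cochains A mu.
have hc : continuous_morphism (fst : G -> L 2).
  by split => // z; exact: cvg_fst.
have hrho r : continuous_morphism (fun z : G => z.2 r).
  split=> // z V; rewrite /= => /(@ptws_eval_continuous R (L 1) r z.2) h.
  exact: (@cvg_snd _ _ (nbhs z.1) (nbhs z.2) _ _ h).
rewrite (_ : cocycles A mu = [set z : G | {ae mu 1, forall v : borel 'rV[C]_1,
    app2 z.1 (v 0 0) 0 = 0}] `&`
  ([set z : G | {ae mu 2, forall v : borel 'rV[C]_2,
    app2 z.1 (v 0 0) (v 0 1) = app2 z.1 (v 0 1) (v 0 0)}] `&`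
  ([set z : G | {ae mu 3, forall v : borel 'rV[C]_3,
    app2 z.1 (v 0 0) (v 0 1) + app2 z.1 (v 0 0 + v 0 1) (v 0 2) =
    app2 z.1 (v 0 0) (v 0 1 + v 0 2) + app2 z.1 (v 0 1) (v 0 2)}] `&`
  ([set z : G | forall r, {ae mu 2, forall v : borel 'rV[C]_2,
    app1 (z.2 r) (v 0 0) + app1 (z.2 r) (v 0 1) - app1 (z.2 r) (v 0 0 + v 0 1) =
    r *! app2 z.1 (v 0 0) (v 0 1) - app2 z.1 (r *! v 0 0) (r *! v 0 1)}] `&`
  ([set z : G | forall r s, {ae mu 1, forall v : borel 'rV[C]_1,
    app1 (z.2 (r + s)) (v 0 0) = app1 (z.2 r) (v 0 0) + app1 (z.2 s) (v 0 0)
      + app2 z.1 (r *! v 0 0) (s *! v 0 0)}] `&`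
  ([set z : G | forall r s, {ae mu 1, forall v : borel 'rV[C]_1,
    app1 (z.2 (r * s)) (v 0 0) = r *! app1 (z.2 s) (v 0 0) + app1 (z.2 r) (s *! v 0 0)}] `&`
  ([set z : G | {ae mu 1, forall v : borel 'rV[C]_1, app1 (z.2 0) (v 0 0) = 0}] `&`
   [set z : G | {ae mu 1, forall v : borel 'rV[C]_1, app1 (z.2 1) (v 0 0) = 0}]))))))); last first.
  apply/seteqP; split => z /=.
    by move=> [? ? ? [? ? ? ? ?]]; do 7!(split => //).
  by move=> [? [? [? [? [? [? [? ?]]]]]]]; split => //; split.
(* Each identity is now an equality of representable expressions; the families over [r] and [s] are
   intersections of closed subgroups. *)
do 7?[apply: closed_subgroupI]; try (apply: closed_subgroup_forall => r);
  try (apply: closed_subgroup_forall => s); apply: representable_eq => //.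
all: try exact: representable_zero.
all: repeat first [apply: representable_sub|apply: representable_add|
  apply: representable_act|apply: representable_app1|apply: representable_app2] => //.
all: try exact: linear_form_zero.
all: try exact: coord.
all: try (apply: lact; exact: coord).
all: try (apply: ladd; exact: coord).
Qed.

End Representable.

(** The letters stand for the values of [f] at [x], [y], [z], [x + y], [y + z] and [x + y + z]; the
    inner values [ab] and [bc] cancel. *)
Lemma cocycle_sum (V : zmodType) (a b c ab bc abc : V) :
  (a + b - ab) + (ab + c - abc) = (a + bc - abc) + (b + c - bc).
Proof.
rewrite [RHS]addrC !addrA subrK [b + c - bc + a]addrAC subrK.
by rewrite [b + c + a]addrC addrA.
Qed.

(** * Coboundaries *)

Section Coboundaries.
Variables (K : realType) (R : pzRingType) (C A : polishModType K R).
Variable mu : forall n, probability (borel 'rV[C]_n) K.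
Hypothesis mu_control : control_measures mu.

Local Notation L n := (L0 (mu n) A).

Let coord m (j : 'I_m) := @linear_form_coord K R C m j.
Let lin0 m := @linear_form_zero K R C m.
Let ladd := @linear_form_add K R C.
Let lact := @linear_form_act K R C.

(** By construction the formula for [delta f] holds at [mu 2]-almost every pair; pulled back, it
    becomes available at the linear arguments of the cocycle identities. *)
Lemma delta_at (f : L 1) m (phi psi : 'rV[C]_m -> C) : (0 < m)%N ->
  linear_form phi -> linear_form psi ->
  {ae mu m, forall v : borel 'rV[C]_m, app2 (delta f) (phi v) (psi v) =
    app1 f (phi v) + app1 f (psi v) - app1 f (phi v + psi v)}.
Proof.
move=> m0 hphi hpsi.
have := pull_ae mu_control m0 (isT : (0 < 2)%N)
  (phi := fun i => if i == ord0 then phi else psi)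
  (fun i => if i == ord0 as b return linear_form (if b then phi else psi)
            then hphi else hpsi)
  (L0_classE (mu 2) (delta_measurable f)).
move=> h; apply: (ae_imp h) => v; rewrite !mxE /= => <-; rewrite /app2; congr L0_fun.
by apply/rowP => -[[|[|//]] i]; rewrite !mxE.
Qed.

Lemma partial_at (f : L 1) r m (phi : 'rV[C]_m -> C) : (0 < m)%N -> linear_form phi ->
  {ae mu m, forall v : borel 'rV[C]_m, app1 (partial r f) (phi v) =
    r *! app1 f (phi v) - app1 f (r *! phi v)}.
Proof.
move=> m0 hphi.
have := pull_ae mu_control m0 (isT : (0 < 1)%N) (phi := fun=> phi) (fun=> hphi)
  (L0_classE (mu 1) (partial_measurable f r)).
move=> h; apply: (ae_imp h) => v; rewrite !mxE /= => <-; rewrite /app1; congr L0_fun.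
by apply/rowP => i; rewrite !mxE ord1.
Qed.

Let id_morphism : continuous_morphism (id : L 1 -> L 1).
Proof. by split => // f; exact: cvg_id. Qed.

Lemma delta_morphism : continuous_morphism (@delta K R C A mu).
Proof.
apply: (representable_class (F := fun (f : L 1) (v : 'rV[C]_2) =>
  app1 f (v 0 0) + app1 f (v 0 1) - app1 f (v 0 0 + v 0 1))).
  apply: representable_sub; first apply: representable_add;
    apply: representable_app1 => //; try exact: coord.
  by apply: ladd; exact: coord.
by move=> f; exact: (L0_classE (mu 2) (delta_measurable f)).
Qed.

Lemma partial_morphism r : continuous_morphism (@partial K R C A mu r).
Proof.
apply: (representable_class (F := fun (f : L 1) (v : 'rV[C]_1) =>
  r *! app1 f (v 0 0) - app1 f (r *! v 0 0))).
  apply: representable_sub; first apply: representable_act;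
    apply: representable_app1 => //; try exact: coord.
  by apply: lact; exact: coord.
by move=> f; exact: (L0_classE (mu 1) (partial_measurable f r)).
Qed.

Lemma cobord_morphism : continuous_morphism (@cobord K R C A mu).
Proof.
have [dB cd] := delta_morphism; split.
  move=> f g; congr (_, _); first exact: dB.
  by apply/funext => r; exact: (partial_morphism r).1.
have cp : continuous (fun f : L 1 => (fun r => partial r f) : {ptws R -> L 1}).
  by apply: ptws_continuous => r; exact: (partial_morphism r).2.
move=> f; exact: (cvg_pair (cd f) (cp f)).
Qed.

Lemma ae_const n (P : Prop) : {ae mu n, forall _ : borel 'rV[C]_n, P} -> P.
Proof.
move=> [N [mN N0 PN]]; apply: contrapT => nP.
have : mu n setT = 0%E.
  by apply: (subset_measure0 (B := N)) => // x _; apply: PN.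
by rewrite probability_setT => /eqP; rewrite onee_eq0.
Qed.

(** The constant 0 is a linear form, so [app1 f 0] is a representable expression in [f]; as the
    total mass is 1, an almost everywhere statement that does not involve the point just holds. *)
Lemma closed_subgroup_normalized : closed_subgroup (normalized A mu).
Proof.
rewrite (_ : normalized A mu = [set f : L 1 | {ae mu 1, forall v : borel 'rV[C]_1,
    app1 f 0 = 0}]).
  apply: representable_eq => //; last exact: representable_zero.
  by apply: (representable_app1 _ _ id_morphism (lin0 1)).
apply/seteqP; split => f; last exact: ae_const.
by rewrite /normalized /= => f0; apply: aeW => x.
Qed.

(** The normalization gives [c x 0 = 0] and [rho 0 x = 0]; the other identities follow formally from
    the formulas for [delta] and [partial] and the module laws. *)
Lemma cobord_cocycle f : normalized A mu f -> cocycles A mu (cobord f).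
Proof.
rewrite /normalized /= => f0; split => /=; [| | |split] => /=.
- apply: (ae_imp (delta_at f (isT : (0 < 1)%N) (coord 0) (lin0 1))) => v ->.
  by rewrite f0 !addr0 subrr.
- have h1 := delta_at f (isT : (0 < 2)%N) (coord 0) (coord 1).
  have h2 := delta_at f (isT : (0 < 2)%N) (coord 1) (coord 0).
  apply: (ae_imp (ae_and h1 h2)) => v [-> ->].
  by rewrite [v 0 1 + _]addrC [app1 f (v 0 1) + _]addrC.
- have h1 := delta_at f (isT : (0 < 3)%N) (coord 0) (coord 1).
  have h2 := delta_at f (isT : (0 < 3)%N) (ladd (coord 0) (coord 1)) (coord 2).
  have h3 := delta_at f (isT : (0 < 3)%N) (coord 0) (ladd (coord 1) (coord 2)).
  have h4 := delta_at f (isT : (0 < 3)%N) (coord 1) (coord 2).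
  apply: (ae_imp (ae_and (ae_and h1 h2) (ae_and h3 h4))) => v [[-> ->] [-> ->]].
  by rewrite -[v 0 0 + v 0 1 + v 0 2]addrA; exact: cocycle_sum.
- move=> r.
  have h1 := partial_at f r (isT : (0 < 2)%N) (coord 0).
  have h2 := partial_at f r (isT : (0 < 2)%N) (coord 1).
  have h3 := partial_at f r (isT : (0 < 2)%N) (ladd (coord 0) (coord 1)).
  have h4 := delta_at f (isT : (0 < 2)%N) (coord 0) (coord 1).
  have h5 := delta_at f (isT : (0 < 2)%N) (lact r (coord 0)) (lact r (coord 1)).
  apply: (ae_imp (ae_and (ae_and h1 h2) (ae_and h3 (ae_and h4 h5)))).
  move=> v [[-> ->] [-> [-> ->]]].
  by rewrite addrACA -opprD sub_interchange actB !actDr.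
- move=> r s.
  have h1 := partial_at f (r + s) (isT : (0 < 1)%N) (coord 0).
  have h2 := partial_at f r (isT : (0 < 1)%N) (coord 0).
  have h3 := partial_at f s (isT : (0 < 1)%N) (coord 0).
  have h4 := delta_at f (isT : (0 < 1)%N) (lact r (coord 0)) (lact s (coord 0)).
  apply: (ae_imp (ae_and (ae_and h1 h2) (ae_and h3 h4))) => v [[-> ->] [-> ->]].
  by rewrite [X in _ = X + _]addrACA -opprD subrKA !actDl.
- move=> r s.
  have h1 := partial_at f (r * s) (isT : (0 < 1)%N) (coord 0).
  have h2 := partial_at f s (isT : (0 < 1)%N) (coord 0).
  have h3 := partial_at f r (isT : (0 < 1)%N) (lact s (coord 0)).
  apply: (ae_imp (ae_and h1 (ae_and h2 h3))) => v [-> [-> ->]].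
  by rewrite actB subrKA !actA.
- apply: (ae_imp (partial_at f 0 (isT : (0 < 1)%N) (coord 0))) => v ->.
  by rewrite !act0l f0 subr0.
- apply: (ae_imp (partial_at f 1 (isT : (0 < 1)%N) (coord 0))) => v ->.
  by rewrite !act1l subrr.
Qed.

End Coboundaries.

(** * The Polish topology on the coboundaries *)

Lemma into_subgroup_continuous (T : topologicalType) (G : preTopZmodType) (H : set G)
    (HH : is_subgroup H) (f : T -> subgroup_type HH) :
  continuous (fun t => val (f t) : G) -> continuous f.
Proof.
move=> cf t V /nbhs_subgroup[W Wt WV].
by apply: (@filterS _ (nbhs t) (nbhs_filter t) _ _ _ (cf t W Wt)) => u /WV.
Qed.

Theorem proposition5p3 (K : realType) (R : pzRingType) (C A : polishModType K R)
    (mu : forall n, probability (borel 'rV[C]_n) K)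
    (R_countable : countable [set: R])
    (C_locally_compact : locally_compact [set: C])
    (A_pro_lie : pro_lie K A)
    (mu_control : control_measures mu) :
  exists HZ : is_subgroup (cocycles A mu),
  [/\ closed (cocycles A mu), polish_group K (subgroup_type HZ) &
  exists HB : is_subgroup (coboundaries_in HZ),
  [/\ coboundaries A mu `<=` cocycles A mu,
      polishable K HB,
      exists (H0 : is_subgroup (normalized A mu))
             (Hk : is_subgroup (cobord_ker H0))
             (Dbar : {additive quot_group Hk -> subgroup_type HB}),
        [/\ bijective Dbar,
            forall f, val (val (Dbar (coset_pi Hk f))) = cobord (val f) &
            polishing K (transport Dbar)] &
      group_with_polish_cover K (Ext1coc HB)]].
Proof.
have cpL n := cochain_complete_group A mu n.
have cpG : complete_group (cochains A mu).
  exact: complete_group_pair (cpL 2) (complete_group_ptws R_countable (cpL 1)).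
have [HZ clZ] := closed_subgroup_cocycles A mu_control.
have cpZ := complete_group_subgroup HZ cpG clZ.
have polZ := complete_group_polish K cpZ.
have [DB cD] := cobord_morphism A mu_control.
have [H0 clN] := closed_subgroup_normalized A mu_control.
have cpN := complete_group_subgroup H0 (cpL 1) clN.
have HB : is_subgroup (coboundaries_in HZ).
  split=> [|x y [f Nf fx] [g Ng gy]].
    by exists 0; [exact: H0.1|exact: (sub_morph0 DB)].
  by exists (f - g); [exact: H0.2|rewrite DB fx gy subgroup_valB].
have [Hk clk] : closed_subgroup (cobord_ker H0).
  apply: (@closed_subgroup_kernel _ _ (fun f : subgroup_type H0 => cobord (val f))) => //.
  split=> [f g|f]; first by rewrite subgroup_valB DB.
  exact: (cvg_comp _ _ (@subgroup_val_continuous _ _ H0 f) (cD (val f))).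
exists HZ; split=> //; exists HB.
have cobZ (f : subgroup_type H0) : cocycles A mu (cobord (val f)).
  by apply: cobord_cocycle => //; exact: set_mem (valP f).
pose z (f : subgroup_type H0) : subgroup_type HZ := exist _ (cobord (val f)) (mem_set (cobZ f)).
have zB f : coboundaries_in HZ (z f).
  by exists (val f) => //; exact: set_mem (valP f).
pose b (f : subgroup_type H0) : subgroup_type HB := exist _ (z f) (mem_set (zB f)).
(* [repr] picks an element of the coset; [Dpi] shows that the choice does not matter. *)
pose D (q : quot_group Hk) : subgroup_type HB := b (repr q).
have Dpi f : val (val (D (coset_pi Hk f))) = cobord (val f).
  pose g := repr (coset_pi Hk f).
  have /coset_piP h : coset_pi Hk g = coset_pi Hk f by rewrite {1}/coset_pi reprK.
  have : cobord (val (g - f)) = 0 := h.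
  by rewrite subgroup_valB DB => /eqP; rewrite subr_eq0 => /eqP.
have val2_inj (x y : subgroup_type HB) : val (val x) = val (val y) -> x = y.
  by move=> xy; apply: val_inj; apply: val_inj.
have DsubB : {morph D : q r / q - r}.
  move=> q r; have [f ->] := coset_pi_surj q; have [g ->] := coset_pi_surj r.
  apply: val2_inj; rewrite -coset_piB Dpi !subgroup_valB !Dpi; exact: DB.
pose Dbar : {additive quot_group Hk -> subgroup_type HB} :=
  HB.pack D (GRing.isZmodMorphism.Build _ _ D DsubB).
have Dbij : bijective Dbar.
  have inj : injective Dbar.
    move=> q r; have [f ->] := coset_pi_surj q; have [g ->] := coset_pi_surj r.
    move=> fg; apply/coset_piP; rewrite -[cobord_ker _ _]/(cobord (val (f - g)) = 0).
    by rewrite subgroup_valB DB -!Dpi -[D]/(Dbar : _ -> _) fg subrr.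
  have surj (x : subgroup_type HB) : exists q, Dbar q = x.
    have [f Nf fx] := set_mem (valP x).
    exists (coset_pi Hk (exist _ f (mem_set Nf))); apply: val2_inj.
    by rewrite Dpi /= fx.
  have [g gP] := choice surj.
  by exists g => // q; apply: inj; rewrite gP.
have polD : polishing K (transport Dbar).
  split.
    apply: (@polish_group_transport K (quot_group Hk) (retopo (transport Dbar)) Dbar).
    - exact: DsubB.
    - exact: Dbij.
    - by [].
    - apply: complete_group_polish.
      by apply: complete_group_quot clk => //; exact: cg_sub.
  (* Openness in the transported topology unfolds to openness in [subgroup_type H0] of the preimage
     under the projection followed by [D]. With the inclusion into the cocycles this composite is
     [z], continuous because [cobord] is. *)
  apply/continuousP => V oV.
  have cz : continuous z.
    apply: into_subgroup_continuous => f.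
    exact: (cvg_comp _ _ (@subgroup_val_continuous _ _ H0 f) (cD (val f))).
  suff : open ((fun f => val (D (coset_pi Hk f))) @^-1` V) by [].
  rewrite (_ : (fun f => _) = z); first by move/continuousP : cz; apply.
  by apply/funext => f; apply: val_inj; exact: Dpi.
have polB : polishable K HB by exists (transport Dbar).
split.
- by move=> _ [f Nf <-]; exact: cobord_cocycle.
- exact: polB.
- by exists H0, Hk, Dbar.
- exact: PolishCover.
Qed.
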